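(* Fix a time $t$. Let $A_t\in\mathbb R^{n\times n}$, $B_t\in\mathbb R^{n\times(n+p)}$, $C_t\in\mathbb R^{p\times n}$, $D_t\in\mathbb R^{p\times(n+p)}$ with $D_tD_t^T>0$ (no assumption is made on $B_t$), let $\hat x_t\in\mathbb R^n$, and let $\tilde P_t\in\mathbb R^{n\times n}$ be symmetric positive semidefinite with $\operatorname{rank}(\tilde P_t)=r_t$ (possibly singular). Let $z_t=[x_{t+1}^T\; y_t^T]^T$ and let $f_t(z_t|Y_{t-1})\sim\mathcal N(m_{z_t},K_{z_t})$ be the (possibly degenerate) pseudo-nominal Gaussian density with $$m_{z_t}=\begin{bmatrix}A_t\\ C_t\end{bmatrix}\hat x_t,\qquad K_{z_t}=\begin{bmatrix}A_t\\ C_t\end{bmatrix}\tilde P_t\begin{bmatrix}A_t^T & C_t^T\end{bmatrix}+\begin{bmatrix}B_t\\ D_t\end{bmatrix}\begin{bmatrix}B_t^T & D_t^T\end{bmatrix}=\begin{bmatrix}K_{x_{t+1}} & K_{x_{t+1},y_t}\\ K_{y_t,x_{t+1}} & K_{y_t}\end{bmatrix}.$$ Let $P_{t+1}:=K_{x_{t+1}}-K_{x_{t+1},y_t}K_{y_t}^{-1}K_{y_t,x_{t+1}}$ and $r_{t+1}:=\operatorname{rank}(P_{t+1})$, and let $H_t\in\mathbb R^{r_{t+1}\times n}$ be such that $H_t^TH_t$ is the projection matrix with image $\mathrm{Im}(P_{t+1})$. Let $c_t$ denote the tolerance (the mismodeling budget allowed at time $t$), and let $\mathcal B_t$ be the set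 of Gaussian densities $\tilde f_t\sim\mathcal N(\tilde m_{z_t},\tilde K_{z_t})$ with the same support as $f_t$ and with $D(\tilde f_t,f_t)\le c_t$. Consider the minimax game $$\hat x_{t+1}=\underset{g_t\in\mathcal G_t}{\operatorname{argmin}}\ \max_{\tilde f_t\in\mathcal B_t}\bar J_t(\tilde f_t,g_t),\qquad \bar J_t(\tilde f_t,g_t)=\int_{\mathcal A_t}\|H_t(x_{t+1}-g_t(y_t))\|^2\,\tilde f_t(z_t|Y_{t-1})\,dz_t,$$ where $\mathcal A_t$ is the support of $f_t$ and $\mathcal G_t$ is the set of estimators $g_t$ for which $\bar J_t(\tilde f_t,g_t)$ is bounded with respect to all $\tilde f_t\in\mathcal B_t$. Then: 1. The robust estimator (one-step-ahead predictor) is $$\hat x_{t+1}=A_t\hat x_t+G_t(y_t-C_t\hat x_t),\qquad G_t=K_{x_{t+1},y_t}K_{y_t}^{-1}=(A_t\tilde P_tC_t^T+B_tD_t^T)(C_t\tilde P_tC_t^T+D_tD_t^T)^{-1}.$$ 2. The nominal posterior covariance of $x_{t+1}$ given $Y_t$ is $$P_{t+1}=A_t\tilde P_tA_t^T-G_t(C_t\tilde P_tC_t^T+D_tD_t^T)G_t^T+B_tB_t^T .$$ 3. The least favorable density is $\tilde f_t^0\sim\mathcal N(m_{z_t},\tilde K_{z_t})$ with $$\tilde K_{z_t}=\begin{bmatrix}\tilde K_{x_{t+1}} & K_{x_{t+1},y_t}\\ K_{y_t,x_{t+1}} & K_{y_t}\end{bmatrix},$$ and its posterior covariance $\tilde P_{t+1}:=\tilde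 K_{x_{t+1}}-K_{x_{t+1},y_t}K_{y_t}^{-1}K_{y_t,x_{t+1}}$ is $$\tilde P_{t+1}=\left(P_{t+1}^+-\lambda_t^{-1}H_t^TH_t\right)^+ ,$$ where $\lambda_t>\sigma_{max}\big(H_tH_t^T(H_tP_{t+1}^+H_t^T)^{-1}H_tH_t^T\big)$ is the unique solution of $$\tfrac12\left\{\ln\det{}^+(P_{t+1})-\ln\det{}^+(\tilde P_{t+1})+\operatorname{tr}(P_{t+1}^+\tilde P_{t+1})-r_{t+1}\right\}=c_t .$$ 4. Put $\theta_t:=\lambda_t^{-1}$ (the time-varying risk sensitivity parameter). In the situation that $c_t=0$ (the actual model corresponds to the nominal model), one has $\theta_t=0$ and thus $\tilde P_{t+1}=P_{t+1}$; the recursion for $P_{t+1}$ becomes the usual Riccati equation and one obtains the standard Kalman filter.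
   Context: Background: the nominal model is $x_{t+1}=A_tx_t+B_tv_t$, $y_t=C_tx_t+D_tv_t$ with $v_t$ normalized white Gaussian noise; $Y_{t-1}=\{y_0,\dots,y_{t-1}\}$; the a priori conditional density of $x_t$ given $Y_{t-1}$ is assumed to be $\mathcal N(\hat x_t,\tilde P_t)$, and $f_t$ is the density of $z_t$ given $Y_{t-1}$ obtained by integrating the nominal transition density of $z_t$ given $x_t$ against it. For the statement, $Y_{t-1}$ (hence $\hat x_t$) is fixed. For a symmetric matrix $K$, $K>0$ means positive definite, $\sigma_{max}(K)$ is its largest eigenvalue, $K^+$ is the Moore–Penrose pseudo-inverse, $\det^+(K)$ is the pseudo-determinant (product of the nonzero eigenvalues), and $\mathrm{Im}(K)$ is the image. A (possibly degenerate) Gaussian density $\mathcal N(m,K)$ with $K$ symmetric positive semidefinite of rank $\rho$ is the function $[(2\pi)^{\rho}\det^+(K)]^{-1/2}\exp[-\frac12(z-m)^TK^+(z-m)]$ on its support $\{m+v: v\in\mathrm{Im}(K)\}$, with respect to Lebesgue measure on that affine subspace. Two Gaussian densities $\mathcal N(m,K)$ and $\mathcal N(\tilde m,\tilde K)$ have the same support if and only if $\mathrm{Im}(\tilde K)=\mathrm{Im}(K)$ and $\tilde m-m\in\mathrm{Im}(K)$. For densities $\tilde f,f$ with the same support $\mathcal A$, the Kullback–Leibler divergence is $D(\tilde f,f)=\int_{\mathcal A}\ln(\tilde f(z)/f(z))\tilde f(z)\,dz$. Estimators are functions $g_t:\mathbb R^p\to\mathbb R^n$ of $y_t$; the predictor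 $\hat x_{t+1}$ is the optimal $g_t$ evaluated at $y_t$. The least favorable density $\tilde f_t^0$ maximizes $\bar J_t(\tilde f_t,g_t)$ over $\tilde f_t\in\mathcal B_t$ when $g_t$ is the optimal estimator.
   Formalization: Parts 3 and 4 are stated for r_{t+1} ≥ 1 (if r_{t+1} = 0 the equation for λ_t reads 0 = c_t); c_t ≥ 0, with λ_t = +∞ when c_t = 0; the optimal estimator is unique only up to the kernel of H_t and null sets of y_t. *)

(* Defs.v *)
From HB Require Import structures.
From mathcomp Require Import all_boot all_order all_algebra.
From mathcomp Require Import all_classical all_reals all_analysis.

Set Implicit Arguments.
Unset Strict Implicit.
Unset Printing Implicit Defensive.

Import Order.TTheory GRing.Theory Num.Theory.
Import numFieldNormedType.Exports.

Local Open Scope classical_set_scope.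
Local Open Scope ring_scope.

Definition cV_coord (R : realType) (k : nat) (i : 'I_k) (v : 'cV[R]_k) : R :=
  v i ord0.

Definition cV_display : measure_display.
Proof. exact. Qed.

Section cV_measurable.
Variables (R : realType) (k : nat).

Let cV_set0 : g_sigma_preimage (@cV_coord R k) set0.
Proof. exact: sigma_algebra0. Qed.

Let cV_setC A :
  g_sigma_preimage (@cV_coord R k) A -> g_sigma_preimage (@cV_coord R k) (~` A).
Proof. exact: sigma_algebraC. Qed.

Let cV_bigcup (F : (set 'cV[R]_k)^nat) :
  (forall i, g_sigma_preimage (@cV_coord R k) (F i)) ->
  g_sigma_preimage (@cV_coord R k) (\bigcup_i F i).
Proof. exact: sigma_algebra_bigcup. Qed.

(* The sigma-algebra generated by the coordinates, i.e. the Borel one. *)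
HB.instance Definition _ := @isMeasurable.Build cV_display 'cV[R]_k
  (g_sigma_preimage (@cV_coord R k)) cV_set0 cV_setC cV_bigcup.

End cV_measurable.

Section cV_measurable_theory.
Variable R : realType.

Lemma measurable_cV_coord k (i : 'I_k) :
  measurable_fun [set: 'cV[R]_k] (cV_coord i).
Proof.
move=> _ Y mY; rewrite setTI; apply: sub_sigma_algebra => /=.
rewrite -bigcup_seq/=; exists i => /=; first by rewrite mem_index_enum.
by exists Y => //; rewrite setTI.
Qed.

Lemma measurable_fun_cVP d (T : measurableType d) k (f : T -> 'cV[R]_k) :
  measurable_fun [set: T] f <->
  forall i, measurable_fun [set: T] (cV_coord i \o f).
Proof.
split=> [mf i|mf]; first exact: measurableT_comp (@measurable_cV_coord k i) mf.
apply: (@measurability _ _ _ _ _ _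
  (\big[setU/set0]_(i < k) preimage_set_system setT (@cV_coord R k i)
     measurable)) => //.
move=> _ [B + <-]; rewrite -bigcup_seq/= => -[i _] [Y mY <-].
by rewrite !setTI; have := mf i measurableT Y mY; rewrite setTI.
Qed.

Definition cV_cons k (xv : R * 'cV[R]_k) : 'cV[R]_k.+1 :=
  \col_i (if unlift ord0 i is Some j then xv.2 j ord0 else xv.1).

Definition cV_uncons k (v : 'cV[R]_k.+1) : R * 'cV[R]_k :=
  (v ord0 ord0, \col_i v (lift ord0 i) ord0).

Lemma cV_consK k : cancel (@cV_cons k) (@cV_uncons k).
Proof.
move=> [x v]; congr (_, _); first by rewrite mxE unlift_none.
by apply/colP => i; rewrite !mxE liftK.
Qed.

Lemma measurable_cV_cons k :
  measurable_fun [set: R * 'cV[R]_k] (@cV_cons k).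
Proof.
apply/measurable_fun_cVP => i.
case: (unliftP ord0 i) => [j|] ->.
- have -> : cV_coord (lift ord0 j) \o @cV_cons k = cV_coord j \o snd.
    by apply/funext => -[x v]; rewrite /= /cV_coord mxE liftK.
  exact: measurableT_comp (@measurable_cV_coord k j) measurable_snd.
- have -> : cV_coord ord0 \o @cV_cons k = fst.
    by apply/funext => -[x v]; rewrite /= /cV_coord mxE unlift_none.
  exact: measurable_fst.
Qed.

Lemma measurable_cV_uncons k :
  measurable_fun [set: 'cV[R]_k.+1] (@cV_uncons k).
Proof.
apply/measurable_fun_pairP; split; first exact: (@measurable_cV_coord k.+1 ord0).
apply/measurable_fun_cVP => i.
have -> : cV_coord i \o (snd \o @cV_uncons k) = cV_coord (lift ord0 i).
  by apply/funext => v; rewrite /= /cV_coord mxE.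
exact: measurable_cV_coord.
Qed.

End cV_measurable_theory.

Section lebesgue_cons.
Variables (R : realType) (k : nat).
Variable mu : {sigma_finite_measure set 'cV[R]_k -> \bar R}.

Let m := pushforward (lebesgue_measure \x mu)%E (@cV_cons R k).

Let m0 : m set0 = 0%E.
Proof. by rewrite /m /pushforward preimage_set0 measure0. Qed.

Let m_ge0 A : (0 <= m A)%E.
Proof. by rewrite /m /pushforward; exact: measure_ge0. Qed.

Let m_sigma_additive : semi_sigma_additive m.
Proof.
exact: (@measure_semi_sigma_additive _ _ _
  (measure_function_pushforward__canonical__measure_function_Measure
     (lebesgue_measure \x mu)%E (@measurable_cV_cons R k))).
Qed.

Definition lebesgue_cons : set 'cV[R]_k.+1 -> \bar R := m.

HB.instance Definition _ := isMeasure.Build _ _ _ lebesgue_cons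
  m0 m_ge0 m_sigma_additive.

Let m_sigma_finite : sigma_finite setT lebesgue_cons.
Proof.
have /sigma_finiteP[F [TF ndF Foo]] := sigma_finiteT (@lebesgue_measure R).
have /sigma_finiteP[G [TG ndG Goo]] := sigma_finiteT mu.
exists (fun i => @cV_uncons R k @^-1` (F i `*` G i)).
  rewrite -preimage_bigcup -[LHS](@preimage_setT _ _ (@cV_uncons R k)).
  congr (_ @^-1` _); rewrite -setXTT TF TG predeqE => -[x y]; split.
    move=> [/= [i _ Fix] [j _ Gjy]]; exists (maxn i j) => //; split.
    - by move: x Fix; exact/subsetPset/ndF/leq_maxl.
    - by move: y Gjy; exact/subsetPset/ndG/leq_maxr.
  by move=> [i _ []/= ? ?]; split; exists i.
move=> i; have [mF Fioo] := Foo i; have [mG Gioo] := Goo i; split.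
  rewrite -[X in measurable X]setTI; apply: measurable_cV_uncons => //.
  exact: measurableX.
rewrite /lebesgue_cons /m /pushforward -comp_preimage.
have -> : @cV_uncons R k \o @cV_cons R k = id by apply/funext/cV_consK.
by rewrite preimage_id product_measure1E// lte_mul_pinfty// ge0_fin_numE.
Qed.

HB.instance Definition _ := Measure_isSigmaFinite.Build _ _ _ lebesgue_cons
  m_sigma_finite.

End lebesgue_cons.

(* k-fold product of the Lebesgue measure of R; R^0 is a point of mass 1. *)
Fixpoint lebesgue_cV (R : realType) (k : nat) :
    {sigma_finite_measure set 'cV[R]_k -> \bar R} :=
  if k is k'.+1 then lebesgue_cons (lebesgue_cV R k')
  else (@dirac _ 'cV[R]_0 0 R).

Section linear_algebra.
Variable R : realType.

Definition sqnorm k (v : 'cV[R]_k) : R := \sum_i v i ord0 ^+ 2.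

Definition psd k (K : 'M[R]_k) : Prop :=
  K^T = K /\ forall v : 'cV[R]_k, 0 <= (v^T *m K *m v) ord0 ord0.

Definition posdef k (K : 'M[R]_k) : Prop :=
  K^T = K /\ forall v : 'cV[R]_k, v != 0 -> 0 < (v^T *m K *m v) ord0 ord0.

Definition mximage k (K : 'M[R]_k) : set 'cV[R]_k :=
  range (fun v : 'cV[R]_k => K *m v).

Definition projection_onto k (Q : 'M[R]_k) (V : set 'cV[R]_k) : Prop :=
  Q *m Q = Q /\ mximage Q = V.

(* The four Penrose conditions, which determine X. *)
Definition penrose k (K X : 'M[R]_k) : Prop :=
  [/\ K *m X *m K = K, X *m K *m X = X,
      (K *m X)^T = K *m X & (X *m K)^T = X *m K].

Definition mp_inv k (K : 'M[R]_k) : 'M[R]_k := xget 0 [set X | penrose K X].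

(* The eigenvalues with multiplicity. The set below is nonempty when K is
   symmetric, and all its elements are permutations of one another. *)
Definition eigenvalues k (K : 'M[R]_k) : seq R :=
  xget [::] [set s | char_poly K = \prod_(a <- s) ('X - a%:P)].

Definition pdet k (K : 'M[R]_k) : R :=
  \prod_(a <- eigenvalues K | a != 0) a.

Definition sigma_max k (K : 'M[R]_k) : R := sup [set a | eigenvalue K a].

End linear_algebra.

Section gaussian.
Variables (R : realType) (N : nat).
Implicit Types (m : 'cV[R]_N) (K : 'M[R]_N) (f : 'cV[R]_N -> R).

Definition gauss_supp m K : set 'cV[R]_N := [set m + v | v in mximage K].

(* The columns of the result are an orthonormal basis of the image of K. *)
Definition orthobasis K : 'M[R]_(N, \rank K) :=
  xget 0 [set W | W^T *m W = 1%:M /\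
                  range (fun u : 'cV[R]_(\rank K) => W *m u) = mximage K].

(* Lebesgue measure of the affine subspace gauss_supp m K, as the image of the
   Lebesgue measure of R^(\rank K) under an isometric parametrization; it does
   not depend on the chosen basis, nor on the chosen base point m. *)
Definition aff_lebesgue m K : set 'cV[R]_N -> \bar R :=
  pushforward (lebesgue_cV R (\rank K))
    (fun u : 'cV[R]_(\rank K) => m + orthobasis K *m u).

(* Density with respect to aff_lebesgue m K, extended by 0 off the support. *)
Definition gauss_pdf m K : 'cV[R]_N -> R := fun z =>
  \1_(gauss_supp m K) z *
  ((Num.sqrt ((2 * pi) ^+ \rank K * pdet K))^-1 *
   expR (- (1 / 2) * ((z - m)^T *m mp_inv K *m (z - m)) ord0 ord0)).

(* Kullback-Leibler divergence of densities supported on gauss_supp m K. *)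
Definition KL m K (ft f : 'cV[R]_N -> R) : \bar R :=
  (\int[aff_lebesgue m K]_(z in gauss_supp m K) (ln (ft z / f z) * ft z)%:E)%E.

(* Gaussian densities with the support of N(m, K) and within divergence c. *)
Definition ambiguity_set m K (c : R) : set ('cV[R]_N -> R) :=
  [set ft | exists (mt : 'cV[R]_N) (Kt : 'M[R]_N),
     [/\ psd Kt, gauss_supp mt Kt = gauss_supp m K, ft = gauss_pdf mt Kt &
         (KL m K ft (gauss_pdf m K) <= c%:E)%E]].

End gaussian.

(* z : 'cV[R]_(n + p) stacks x_{t+1} = usubmx z over y_t = dsubmx z. *)
Section game.
Variables (R : realType) (n p r : nat).
Variables (m : 'cV[R]_(n + p)) (K : 'M[R]_(n + p)) (H : 'M[R]_(r, n)) (c : R).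

Definition risk (ft : 'cV[R]_(n + p) -> R) (g : 'cV[R]_p -> 'cV[R]_n) : \bar R :=
  (\int[aff_lebesgue m K]_(z in gauss_supp m K)
     (sqnorm (H *m (usubmx z - g (dsubmx z))) * ft z)%:E)%E.

Definition estimators : set ('cV[R]_p -> 'cV[R]_n) :=
  [set g | measurable_fun setT g /\
           exists M : R, forall ft, ambiguity_set m K c ft ->
             (risk ft g <= M%:E)%E].

Definition worst_risk (g : 'cV[R]_p -> 'cV[R]_n) : \bar R :=
  ereal_sup [set risk ft g | ft in ambiguity_set m K c].

Definition robust_estimator (g : 'cV[R]_p -> 'cV[R]_n) : Prop :=
  estimators g /\
  forall g', estimators g' -> (worst_risk g <= worst_risk g')%E.

Definition least_favorable (g : 'cV[R]_p -> 'cV[R]_n)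
    (ft : 'cV[R]_(n + p) -> R) : Prop :=
  ambiguity_set m K c ft /\
  forall f', ambiguity_set m K c f' -> (risk f' g <= risk ft g)%E.

End game.

Section model.
Variables (R : realType) (n p : nat).
Implicit Types (A : 'M[R]_n) (B : 'M[R]_(n, n + p)) (C : 'M[R]_(p, n))
  (D : 'M[R]_(p, n + p)) (P : 'M[R]_n).

Definition nominal_mean A C (xhat : 'cV[R]_n) : 'cV[R]_(n + p) :=
  col_mx A C *m xhat.

Definition nominal_cov A B C D P : 'M[R]_(n + p) :=
  col_mx A C *m P *m row_mx A^T C^T + col_mx B D *m row_mx B^T D^T.

(* Gain and covariance of the conditional law of x given y when (x, y) is
   Gaussian with covariance K. *)
Definition filter_gain (K : 'M[R]_(n + p)) : 'M[R]_(n, p) :=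
  ursubmx K *m invmx (drsubmx K).

Definition posterior_cov (K : 'M[R]_(n + p)) : 'M[R]_n :=
  ulsubmx K - ursubmx K *m invmx (drsubmx K) *m dlsubmx K.

(* (P^+ - lambda^-1 H^T H)^+, where (+oo)^-1 = 0. *)
Definition robust_cov r (P : 'M[R]_n) (H : 'M[R]_(r, n)) (lambda : \bar R) :
    'M[R]_n :=
  mp_inv (mp_inv P - fine (lambda^-1)%E *: (H^T *m H)).

Definition budget (P Pt : 'M[R]_n) : R :=
  1 / 2 * (ln (pdet P) - ln (pdet Pt) + \tr (mp_inv P *m Pt) - (\rank P)%:R).

(* The standard one-step-ahead Kalman predictor, for process and measurement
   noises that may be correlated. *)
Definition kalman_gain A B C D P : 'M[R]_(n, p) :=
  (A *m P *m C^T + B *m D^T) *m invmx (C *m P *m C^T + D *m D^T).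

Definition kalman_predictor A B C D P (x : 'cV[R]_n) (y : 'cV[R]_p) : 'cV[R]_n :=
  A *m x + kalman_gain A B C D P *m (y - C *m x).

Definition riccati A B C D P : 'M[R]_n :=
  A *m P *m A^T
  - (A *m P *m C^T + B *m D^T) *m invmx (C *m P *m C^T + D *m D^T)
      *m (A *m P *m C^T + B *m D^T)^T
  + B *m B^T.

End model.

(* Main.v *)
(** The support of [N (m, K)] is parametrized by [z = m + Z (v, w)], where [v]
    is [H] applied to the error of the affine estimator and [w] the innovation.
    In these coordinates the nominal law has block diagonal covariance
    [T0 = diag (Q, Ky)] with [P = H^T Q H], every competitor is a nondegenerate
    [N (mu, T)], and the risk of the affine estimator is
    [tr (X T) + mu^T X mu] with [X = diag (1, 0)].

    - Put [T1^-1 = T0^-1 - theta X].  Then [theta] times the risk is twice the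
      divergence plus [ln det T - tr (T1^-1 T) - mu^T T1^-1 mu] up to a
      constant, and Gibbs' inequality [ln det T - tr (T1^-1 T) + k <= ln det T1]
      makes [N (0, T1)] the unique maximizer over the divergence ball on whose
      boundary it lies.
    - If [Q] has eigenvalues [d_i], the divergence of [T1] is half the sum of
      [ln (1 - theta d_i) + 1 / (1 - theta d_i) - 1], which increases strictly
      from 0 to infinity in [theta]; this determines [lambda = 1 / theta].
    - [N (0, T1)] is invariant under [v |-> -v], so under it the risk of any
      estimator is that of the affine one plus the mean square of their
      difference; this gives the saddle point and the uniqueness of the
      estimator. *)
Require Import Defs.
From HB Require Import structures.
From mathcomp Require Import all_boot all_order all_algebra.
From mathcomp Require Import all_classical all_reals all_analysis.
From mathcomp Require Import measurable_realfun normal_distribution.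
From mathcomp Require Import complex spectral ring lra.

Set Implicit Arguments.
Unset Strict Implicit.
Unset Printing Implicit Defensive.

Import Order.TTheory GRing.Theory Num.Theory.
Import numFieldNormedType.Exports.

Local Open Scope classical_set_scope.
Local Open Scope ring_scope.

(** * Matrices *)

Section Spectral.
Variable R : realType.

(** The frame [Z] spans the directions of the support but is not orthonormal, because its innovation
    columns carry the gain. Hence pseudo-inverses, pseudo-determinants and integrals over the
    support are computed for [Z T Z^T] with any injective [Z]. The pseudo-determinant produces a
    factor [\det (Z^T Z)], which is the squared Jacobian of the parametrization, and the two cancel;
    only nondegenerate Gaussians on column vectors remain.

    Two boundary cases escape the tilting argument. If [c = 0], the ball is reduced to the nominal
    law and [theta = 0], so a comparison scaled by [theta] is void; the equality case of Gibbs'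
    inequality replaces it. If [P = 0], there is no eigenvalue to tilt and no multiplier, but every
    risk is zero.

    The risk of a measurable estimator may be infinite, so squares are not expanded by subtracting
    integrals. Cross terms are removed by adding two nonnegative integrals that a reflection
    exchanges. *)

Lemma sym_eigenvalue k (A : 'M[R]_k.+1) : A^T = A -> exists a, eigenvalue A a.
Proof.
(* Over the complex numbers the matrix is Hermitian, so its spectral diagonal is real. Its first
   entry is a root of the characteristic polynomial, and being such a root descends along the
   embedding of [R]. *)
move=> symA; pose f := complex.real_complex R.
pose B := map_mx f A.
have hB : B \is hermsymmx.
  apply: realsym_hermsym.
    apply/is_hermitianmxP; rewrite expr0 scale1r map_mx_id// /B.
    by rewrite map_trmx symA.
  by apply/mxOverP => i j; rewrite mxE complex.complex_real.
have rB := hermitian_spectral_diag_real hB.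
have /orthomx_spectralP eB := hermitian_normalmx hB.
have /complex.complex_realP[a ea] : spectral_diag B 0 0 \is Num.real by exact/mxOverP.
exists a; rewrite eigenvalue_root_char -(fmorph_root f) map_char_poly -/B.
rewrite -eigenvalue_root_char -/(f a).
apply/eigenvalueP; exists (row 0 (spectralmx B)).
  rewrite {2}eB !mulmxA -row_mul mulmxV ?spectral_unit// row1.
  by rewrite -rowE row_diag_mx ea -/(f a) -scalemxAl -rowE.
have free : row_free (spectralmx B) by rewrite /row_free mxrank_unit ?spectral_unit.
apply: contraTneq free => r0; apply/row_freePn; exists 0; rewrite r0.
exact: sub0mx.
Qed.

Lemma sqnormE k (v : 'cV[R]_k) : (v^T *m v) 0 0 = sqnorm v.
Proof. by rewrite mxE /sqnorm; apply: eq_bigr => i _; rewrite mxE expr2. Qed.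

Lemma sqnorm_ge0 k (v : 'cV[R]_k) : 0 <= sqnorm v.
Proof. by apply: sumr_ge0 => i _; rewrite sqr_ge0. Qed.

Lemma sqnorm_eq0 k (v : 'cV[R]_k) : (sqnorm v == 0) = (v == 0).
Proof.
apply/eqP/eqP => [|->]; last first.
  by rewrite /sqnorm big1// => i _; rewrite mxE expr0n.
move=> /eqP; rewrite psumr_eq0; last by move=> i _; rewrite sqr_ge0.
move=> /allP v0; apply/colP => i; rewrite mxE.
by have := v0 i (mem_index_enum i); rewrite /= sqrf_eq0 => /eqP.
Qed.

Lemma sqnorm_gt0 k (v : 'cV[R]_k) : (0 < sqnorm v) = (v != 0).
Proof. by rewrite lt0r sqnorm_eq0 sqnorm_ge0 andbT. Qed.

Lemma sqnormZ k (a : R) (v : 'cV[R]_k) : sqnorm (a *: v) = a ^+ 2 * sqnorm v.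
Proof. by rewrite /sqnorm mulr_sumr; apply: eq_bigr => i _; rewrite mxE exprMn. Qed.

(* A Householder reflection exchanges [u] and the first basis vector. *)
Lemma orthogonal_completion k (u : 'cV[R]_k.+1) : sqnorm u = 1 ->
  exists Q : 'M[R]_k.+1, Q^T *m Q = 1%:M /\ Q *m delta_mx 0 0 = u.
Proof.
move=> u1; pose e : 'cV[R]_k.+1 := delta_mx 0 0.
have [->|ue] := eqVneq u e; first by exists 1%:M; rewrite trmx1 !mul1mx.
pose w := u - e; pose n := sqnorm w.
have n0 : n != 0 by rewrite sqnorm_eq0 subr_eq0.
have ww : w^T *m w = n%:M by rewrite [LHS]mx11_scalar sqnormE.
have uu : u^T *m u = 1%:M by rewrite [LHS]mx11_scalar sqnormE u1.
have ee : e^T *m e = 1%:M.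
  by rewrite /e trmx_delta mul_delta_mx; apply/matrixP => i j; rewrite !mxE !ord1.
(* As [u] and [e] are unit vectors, [n = 2 - 2 b] with [b] their inner product, so
   [w . e = b - 1 = - n / 2]. This makes the reflection send [e] to [e + w = u]. *)
have we : w^T *m e = (- (n / 2))%:M.
  have eu : u^T *m e = ((u^T *m e) 0 0)%:M by exact: mx11_scalar.
  have ue' : e^T *m u = ((u^T *m e) 0 0)%:M.
    by rewrite -[LHS]trmxK trmx_mul trmxK {1}eu tr_scalar_mx.
  set b := (u^T *m e) 0 0 in eu ue'.
  have : n%:M = (2 - 2 * b)%:M :> 'M[R]_1.
    rewrite -ww /w [(u - e)^T]linearB/= mulmxBl !mulmxBr uu ee eu ue'.
    by rewrite -!raddfB/=; congr (_%:M); ring.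
  move=> /matrixP/(_ 0 0); rewrite !mxE !mulr1n => nE.
  rewrite /w linearB/= mulmxBl eu ee -raddfB/= nE; congr (_%:M); lra.
exists (1%:M - (2 / n) *: (w *m w^T)).
have symQ : (1%:M - (2 / n) *: (w *m w^T))^T = 1%:M - (2 / n) *: (w *m w^T).
  by rewrite linearB/= trmx1 linearZ/= trmx_mul trmxK.
split.
  rewrite symQ mulmxBl !mulmxBr !mulmx1 mul1mx -scalemxAl -scalemxAr.
  rewrite mulmxA -(mulmxA w) ww mul_mx_scalar -scalemxAl !scalerA.
  by apply/matrixP => i j; move: (w *m w^T) => X; rewrite !mxE; field.
rewrite mulmxBl mul1mx -scalemxAl -mulmxA we mul_mx_scalar scalerA.
rewrite (_ : _ * _ = -1); last by field.
by rewrite scaleN1r opprK /w addrC subrK.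
Qed.

(** Deflation: an orthogonal matrix moves a unit eigenvector to the first basis vector, symmetry
    then clears the rest of the first row, and the induction hypothesis diagonalizes the remaining
    block. *)
Lemma spectral_decomposition k (A : 'M[R]_k) : A^T = A ->
  exists (Q : 'M[R]_k) (d : 'rV[R]_k),
    Q^T *m Q = 1%:M /\ A = Q *m diag_mx d *m Q^T.
Proof.
elim: k A => [|k IH] A symA.
  exists 1%:M, 0; split; first by rewrite trmx1 mul1mx.
  by apply/matrixP => -[].
have [a /eigenvalueP[v vA v0]] := sym_eigenvalue symA.
have v0' : v^T != 0 by rewrite trmx_eq0.
have nv : 0 < sqnorm v^T by rewrite sqnorm_gt0.
pose u := (Num.sqrt (sqnorm v^T))^-1 *: v^T.
have u1 : sqnorm u = 1.
  by rewrite /u sqnormZ exprVn sqr_sqrtr ?mulVf ?gt_eqF// ltW.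
have Au : A *m u = a *: u.
  by rewrite /u -scalemxAr -{1}symA -trmx_mul vA linearZ/= !scalerA mulrC.
have [Q1 [Q1Q1 Q1e]] := orthogonal_completion u1.
have Q1Q1' := mulmx1C Q1Q1.
pose B : 'M[R]_k.+1 := Q1^T *m A *m Q1.
have symB : B^T = B by rewrite /B !trmx_mul trmxK symA mulmxA.
have Be : B *m delta_mx 0 0 = a *: delta_mx 0 0 :> 'cV[R]_k.+1.
  rewrite /B -mulmxA Q1e -mulmxA Au -Q1e -scalemxAr mulmxA Q1Q1.
  by rewrite mul1mx.
have Bi0 (i : 'I_k.+1) : B i 0 = a * (i == 0)%:R.
  have := congr1 (fun M : 'cV[R]_k.+1 => M i 0) Be.
  by rewrite -colE !mxE eqxx andbT.
have BQ : B = Q1^T *m A *m Q1 by [].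
clearbody B.
have l0 : @lshift 1 k 0 = 0 by exact/val_inj.
pose B' := @drsubmx _ 1 k 1 k B.
have BE : B = block_mx (a%:M) 0 0 B' :> 'M[R]_(1 + k).
  rewrite -[LHS](@submxK _ 1 k 1 k); congr block_mx.
  - by apply/matrixP => i j; rewrite !ord1 !mxE l0 Bi0 eqxx mulr1 mulr1n.
  - apply/matrixP => i j; rewrite !ord1 -symB !mxE l0.
    by rewrite Bi0 mulr0.
  - apply/matrixP => i j; rewrite !ord1 !mxE l0.
    by rewrite Bi0 mulr0.
have symB' : B'^T = B' by rewrite /B' trmx_drsub; congr drsubmx.
have [Q' [d' [Q'1 B'E]]] := IH _ symB'.
(* Block matrices need the index in the form [1 + k]; the result is retyped at [k.+1] by conversion
   just below. *)
have key : exists (Q2 : 'M[R]_(1 + k)) (d : 'rV[R]_(1 + k)),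
    Q2^T *m Q2 = 1%:M /\ block_mx a%:M 0 0 B' = Q2 *m diag_mx d *m Q2^T.
  exists (block_mx 1%:M 0 0 Q'), (row_mx a%:M d').
  rewrite tr_block_mx diag_mx_row !mulmx_block.
  rewrite !trmx0 !trmx1 !mulmx0 !mul0mx !mulmx1 Q'1 !mul1mx !addr0 !add0r -B'E.
  rewrite !mul0mx -scalar_mx_block; split=> //; congr block_mx.
  by apply/matrixP => i j; rewrite !ord1 !mxE.
rewrite -BE in key.
have [Q2 [d [Q2Q2 Q2B]]] : exists (Q2 : 'M[R]_k.+1) (d : 'rV[R]_k.+1),
    Q2^T *m Q2 = 1%:M /\ B = Q2 *m diag_mx d *m Q2^T := key.
exists (Q1 *m Q2), d; split.
  by rewrite trmx_mul mulmxA -(mulmxA _ Q1^T) Q1Q1 mulmx1.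
rewrite trmx_mul !mulmxA -!(mulmxA Q1) -Q2B.
by rewrite BQ !mulmxA Q1Q1' mul1mx -mulmxA Q1Q1' mulmx1.
Qed.

End Spectral.

(** * Positive definite matrices and Gibbs' inequality for log-determinants *)

Section PositiveDefinite.
Variable R : realType.

Lemma unitmx_inj k (A : 'M[R]_k) :
  (forall v : 'cV[R]_k, A *m v = 0 -> v = 0) -> A \in unitmx.
Proof.
move=> inj; rewrite -unitmx_tr -row_free_unit -kermx_eq0; apply/rowV0P => v.
move=> /sub_kermxP vA0; apply/eqP; rewrite -trmx_eq0; apply/eqP; apply: inj.
by rewrite -[A]trmxK -trmx_mul vA0 trmx0.
Qed.

Lemma quadE k l (M : 'M[R]_(k, l)) (v : 'cV[R]_k) :
  (v^T *m (M *m M^T) *m v) ord0 ord0 = sqnorm (M^T *m v).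
Proof. by rewrite -sqnormE trmx_mul trmxK !mulmxA. Qed.

Lemma psd_factor k (S : 'M[R]_k) : psd S -> exists M : 'M[R]_k, S = M *m M^T.
Proof.
move=> [symS psdS]; have [Q [d [QQ SE]]] := spectral_decomposition symS.
have d0 i : 0 <= d ord0 i.
  have := psdS (Q *m delta_mx i ord0).
  rewrite SE trmx_mul !mulmxA -(mulmxA _ Q^T) QQ mulmx1 -(mulmxA _ Q^T) QQ mulmx1.
  by rewrite trmx_delta -rowE row_diag_mx -scalemxAl mul_delta_mx !mxE !eqxx mulr1.
exists (Q *m diag_mx (\row_i Num.sqrt (d ord0 i))).
rewrite trmx_mul tr_diag_mx !mulmxA -(mulmxA Q) mulmx_diag SE.
congr (_ *m diag_mx _ *m _); apply/rowP => i.
by rewrite !mxE -expr2 sqr_sqrtr.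
Qed.

Lemma posdef_psd k (S : 'M[R]_k) : posdef S -> psd S.
Proof.
move=> [symS pS]; split=> // v; have [->|v0] := eqVneq v 0.
  by rewrite mulmx0 mxE.
exact/ltW/pS.
Qed.

Lemma posdef_unitmx k (S : 'M[R]_k) : posdef S -> S \in unitmx.
Proof.
move=> [_ pS]; apply: unitmx_inj => v Sv0; apply/eqP; apply: contraT => /pS.
by rewrite -mulmxA Sv0 mulmx0 mxE ltxx.
Qed.

Lemma posdef_factor k (S : 'M[R]_k) : posdef S ->
  exists2 M : 'M[R]_k, M \in unitmx & S = M *m M^T.
Proof.
move=> pS; have [M SE] := psd_factor (posdef_psd pS); exists M => //.
by have := posdef_unitmx pS; rewrite SE unitmx_mul => /andP[].
Qed.

Lemma psd_unit_posdef k (S : 'M[R]_k) : psd S -> S \in unitmx -> posdef S.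
Proof.
move=> pS uS; split=> [|v v0]; first exact: pS.1.
have [M SE] := psd_factor pS; rewrite {1}SE quadE sqnorm_gt0.
apply: contraNneq v0 => Mv0; apply/eqP.
by rewrite -[v](mulKmx uS) SE -mulmxA Mv0 !mulmx0.
Qed.

Lemma posdef_congr k l (S : 'M[R]_k) (Z : 'M[R]_(k, l)) : posdef S ->
  (forall v : 'cV[R]_l, Z *m v = 0 -> v = 0) -> posdef (Z^T *m S *m Z).
Proof.
move=> [symS pS] inj; split=> [|v v0]; first by rewrite !trmx_mul trmxK symS mulmxA.
rewrite !mulmxA -trmx_mul -!mulmxA mulmxA; apply: pS.
by apply: contraNneq v0 => /inj ->.
Qed.

Lemma psd_congr k l (S : 'M[R]_k) (Z : 'M[R]_(k, l)) :
  psd S -> psd (Z^T *m S *m Z).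
Proof.
move=> [symS pS]; split=> [|v]; first by rewrite !trmx_mul trmxK symS mulmxA.
by rewrite !mulmxA -trmx_mul -!mulmxA mulmxA; exact: pS.
Qed.

Lemma posdef1 k : posdef (1%:M : 'M[R]_k).
Proof.
by split=> [|v]; rewrite ?trmx1// mulmx1 sqnormE sqnorm_gt0.
Qed.

Lemma posdef_gram k l (Z : 'M[R]_(k, l)) :
  (forall v : 'cV[R]_l, Z *m v = 0 -> v = 0) -> posdef (Z^T *m Z).
Proof. by move=> inj; have := posdef_congr (posdef1 k) inj; rewrite mulmx1. Qed.

Lemma unitmx_mulmx_eq0 k (A : 'M[R]_k) (v : 'cV[R]_k) :
  A \in unitmx -> A *m v = 0 -> v = 0.
Proof. by move=> uA Av; rewrite -[v](mulKmx uA) Av mulmx0. Qed.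

Lemma posdef_invmx k (S : 'M[R]_k) : posdef S -> posdef (invmx S).
Proof.
move=> pS; have uS := posdef_unitmx pS.
have -> : invmx S = (invmx S)^T *m S *m invmx S.
  by rewrite -mulmxA mulmxV// mulmx1 trmx_inv pS.1.
by apply: posdef_congr => // v; apply: unitmx_mulmx_eq0; rewrite unitmx_inv.
Qed.

Lemma posdef_det_gt0 k (S : 'M[R]_k) : posdef S -> 0 < \det S.
Proof.
move=> /posdef_factor[M uM ->].
by rewrite det_mulmx det_tr -expr2 exprn_even_gt0//= -unitfE -unitmxE.
Qed.

Lemma psdD k (S T : 'M[R]_k) : psd S -> psd T -> psd (S + T).
Proof.
move=> [sS pS] [sT pT]; split=> [|v]; first by rewrite linearD/= sS sT.
by rewrite mulmxDr mulmxDl mxE addr_ge0.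
Qed.

Lemma posdef_psdD k (S T : 'M[R]_k) : psd S -> posdef T -> posdef (S + T).
Proof.
move=> [sS pS] [sT pT]; split=> [|v v0]; first by rewrite linearD/= sS sT.
by rewrite mulmxDr mulmxDl mxE ltr_wpDl// pT.
Qed.

(** [S] is to be read as a covariance and [X] as a quadratic form, so they transform by [M] and by
    its transpose on opposite sides. A factor of [S] is corrected by the eigenvectors of the
    transported form. *)
Lemma posdef_codiag k (S X : 'M[R]_k) : posdef S -> X^T = X ->
  exists (M : 'M[R]_k) (d : 'rV[R]_k),
    [/\ M \in unitmx, S = M *m M^T & M^T *m X *m M = diag_mx d].
Proof.
move=> /posdef_factor[M uM SE] symX.
have [|Q [d [QQ E]]] := @spectral_decomposition R k (M^T *m X *m M).
  by rewrite !trmx_mul trmxK symX mulmxA.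
exists (M *m Q), d; split.
- by rewrite unitmx_mul uM; have [] := mulmx1_unit QQ.
- by rewrite trmx_mul -mulmxA (mulmxA Q) (mulmx1C QQ) mul1mx.
- rewrite trmx_mul !mulmxA -!(mulmxA Q^T) mulmxA E !mulmxA QQ mul1mx -mulmxA.
  by rewrite QQ mulmx1.
Qed.

Lemma posdef_diag k (d : 'rV[R]_k) : posdef (diag_mx d) -> forall i, 0 < d ord0 i.
Proof.
move=> [_ pd] i; have := pd (delta_mx i ord0).
rewrite trmx_delta -rowE row_diag_mx -scalemxAl mul_delta_mx !mxE !eqxx mulr1.
by apply; apply/eqP => /matrixP/(_ i ord0); rewrite !mxE !eqxx => /eqP; rewrite oner_eq0.
Qed.

Lemma ln_lt_subr1 (x : R) : 0 < x -> x != 1 -> ln x < x - 1.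
Proof.
move=> x0 x1; rewrite -ltr_expR lnK ?posrE//.
have /expR_gt1Dx : x - 1 != 0 by rewrite subr_eq0.
by rewrite addrC subrK.
Qed.

Lemma ln_le_subr1 (x : R) : 0 < x -> ln x <= x - 1.
Proof.
move=> x0; have [->|x1] := eqVneq x 1; first by rewrite ln1 subrr.
exact/ltW/ln_lt_subr1.
Qed.

Lemma ln_prod (I : Type) (s : seq I) (P : pred I) (f : I -> R) :
  (forall i, P i -> 0 < f i) ->
  ln (\prod_(i <- s | P i) f i) = \sum_(i <- s | P i) ln (f i).
Proof.
move=> f0; elim: s => [|i s IH]; first by rewrite !big_nil ln1.
rewrite !big_cons; case: ifP => // Pi; rewrite lnM ?IH// posrE ?f0//.
exact: prodr_gt0.
Qed.

(** In a common basis [T = M M^T] and [S = M D M^T], and the gap between the two sides is the sum of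
    [d_i - 1 - ln d_i]. Each term is nonnegative and vanishes only at [d_i = 1]. *)
Lemma ln_det_gibbs k (S T : 'M[R]_k) : posdef S -> posdef T ->
  ln (\det S) - \tr (invmx T *m S) + k%:R <= ln (\det T) ?= iff (S == T).
Proof.
move=> pS pT; have uT := posdef_unitmx pT.
(* The form [T^-1 S T^-1] is the one whose diagonalization [M^T X M = D] unfolds to
   [S = M D M^T]. *)
have [|M [d [uM TE E]]] := @posdef_codiag k T (invmx T *m S *m invmx T) pT.
  by rewrite !trmx_mul trmx_inv pT.1 pS.1 mulmxA.
have uM' : M^T \in unitmx by rewrite unitmx_tr.
have SE : S = M *m diag_mx d *m M^T.
  by rewrite -E !mulmxA -TE mulmxV// mul1mx -!mulmxA -TE mulVmx// mulmx1.
have d0 : forall i, 0 < d ord0 i.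
  apply: posdef_diag; rewrite -E.
  apply: posdef_congr; last by move=> v; exact: unitmx_mulmx_eq0.
  rewrite -{1}pT.1 -trmx_inv; apply: posdef_congr => // v.
  by apply: unitmx_mulmx_eq0; rewrite unitmx_inv.
have iTE : invmx T = (invmx M)^T *m invmx M.
  apply: (can_inj (mulKmx uT)); rewrite mulmxV// TE mulmxA -(mulmxA M).
  by rewrite -trmx_mul mulVmx// trmx1 mulmx1 mulmxV.
have trE : \tr (invmx T *m S) = \sum_i d ord0 i.
  rewrite SE iTE -!mulmxA (mulKmx uM) mxtrace_mulC -!mulmxA -trmx_mul.
  by rewrite mulVmx// trmx1 mulmx1 mxtrace_diag.
have detE : \det S = \det T * \prod_i d ord0 i.
  by rewrite SE {1}TE !det_mulmx det_diag; ring.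
have detT := posdef_det_gt0 pT.
have pd : 0 < \prod_i d ord0 i by exact: prodr_gt0.
rewrite detE lnM ?posrE// ln_prod// trE -addrA -addrA.
rewrite (_ : _ + _ = ln (\det T) + \sum_i (ln (d ord0 i) - (d ord0 i - 1))); last first.
  congr (_ + _); rewrite sumrB sumrB sumr_const card_ord; ring.
have le0 i : ln (d ord0 i) - (d ord0 i - 1) <= 0 by rewrite subr_le0 ln_le_subr1.
split.
  by rewrite gerDl; apply: sumr_le0.
rewrite -subr_eq0 addrAC subrr add0r; apply/eqP/eqP => [s0|ST]; last first.
  have d1 : \prod_i d ord0 i = 1.
    by apply: (mulfI (lt0r_neq0 detT)); rewrite mulr1 -detE ST.
  rewrite !sumrB -ln_prod// d1 ln1 -trE ST mulVmx// mxtrace1 sumr_const card_ord.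
  by rewrite subrr subr0.
have d1 i : d ord0 i = 1.
  apply/eqP; apply: contraT => di.
  have : \sum_i (ln (d ord0 i) - (d ord0 i - 1)) < 0.
    rewrite (bigD1 i)//=; apply: le_lt_trans (_ : _ <= ln (d ord0 i) - (d ord0 i - 1)) _.
      by rewrite gerDl sumr_le0.
    by rewrite subr_lt0 ln_lt_subr1.
  by rewrite s0 ltxx.
rewrite SE TE (_ : diag_mx d = 1%:M) ?mulmx1//.
by rewrite -diag_const_mx; congr diag_mx; apply/rowP => i; rewrite d1 mxE.
Qed.

End PositiveDefinite.

(** * Moore-Penrose inverse and pseudo-determinant of [Z T Z^T] *)

Section PseudoInverse.
Variable R : realType.

Lemma penrose_uniq k (K X Y : 'M[R]_k) : penrose K X -> penrose K Y -> X = Y.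
Proof.
move=> [KXK XKX KX XK] [KYK YKY KY YK].
have eXY : K *m X = K *m Y.
  have -> : K *m X = K *m Y *m (K *m X) by rewrite mulmxA KYK.
  by rewrite -KX -KY -trmx_mul mulmxA KXK.
have eYX : X *m K = Y *m K.
  have -> : X *m K = X *m K *m (Y *m K) by rewrite -mulmxA (mulmxA K) KYK.
  by rewrite -XK -YK -trmx_mul -mulmxA (mulmxA K) KXK.
by rewrite -XKX -mulmxA eXY mulmxA eYX.
Qed.

Lemma mp_invE k (K X : 'M[R]_k) : penrose K X -> mp_inv K = X.
Proof.
move=> KX; apply: (@penrose_uniq _ K) => //.
by apply: (@xgetPex _ 0 [set X | penrose K X]); exists X.
Qed.

(** With the dual frame [Y = Z (Z^T Z)^-1], both products of the two matrices collapse to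
    [Z Y^T = Y Z^T], the orthogonal projector on the range of [Z]; the four conditions follow. *)
Lemma penrose_congr l k (Z : 'M[R]_(l, k)) (T : 'M[R]_k) :
  Z^T *m Z \in unitmx -> T \in unitmx ->
  penrose (Z *m T *m Z^T)
    (Z *m invmx (Z^T *m Z) *m invmx T *m (Z *m invmx (Z^T *m Z))^T).
Proof.
move=> uZ uT; set Y := Z *m invmx (Z^T *m Z).
have ZY : Z^T *m Y = 1%:M by rewrite /Y mulmxA mulmxV.
have YZ : Y^T *m Z = 1%:M by rewrite -[Z]trmxK -trmx_mul ZY trmx1.
have ZYs : (Z *m Y^T)^T = Z *m Y^T.
  by rewrite trmx_mul trmxK /Y trmx_mul trmx_inv trmx_mul trmxK mulmxA.
clearbody Y.
have KX : Z *m T *m Z^T *m (Y *m invmx T *m Y^T) = Z *m Y^T.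
  by rewrite -!mulmxA (mulmxA Z^T) ZY mul1mx (mulKVmx uT).
have XK : Y *m invmx T *m Y^T *m (Z *m T *m Z^T) = Y *m Z^T.
  by rewrite -!mulmxA (mulmxA Y^T) YZ mul1mx (mulKmx uT).
split; rewrite ?KX ?XK //.
- by rewrite -!mulmxA (mulmxA Y^T) YZ mul1mx.
- by rewrite -!mulmxA (mulmxA Z^T) ZY mul1mx.
- by rewrite trmx_mul trmxK -{2}[Y]trmxK -trmx_mul ZYs.
Qed.

Lemma mp_inv_congr l k (Z : 'M[R]_(l, k)) (T : 'M[R]_k) :
  Z^T *m Z \in unitmx -> T \in unitmx ->
  mp_inv (Z *m T *m Z^T) =
    Z *m invmx (Z^T *m Z) *m invmx T *m (Z *m invmx (Z^T *m Z))^T.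
Proof. by move=> uZ uT; exact/mp_invE/penrose_congr. Qed.

(** Sylvester's identity. The bordered matrix [B] is made block triangular in two ways: by column
    operations, leaving [X - Z A], and by row operations, leaving [X - A Z] at the price of a factor
    [X^k]. *)
Lemma char_poly_mulmxC l k (Z : 'M[R]_(l, k)) (A : 'M[R]_(k, l)) :
  char_poly (Z *m A) * 'X^k = char_poly (A *m Z) * 'X^l.
Proof.
pose Zp := map_mx polyC Z; pose Ap := map_mx polyC A.
pose B := block_mx ('X%:M : 'M[{poly R}]_l) Zp Ap (1%:M : 'M[{poly R}]_k).
have E1 : \det B = char_poly (Z *m A).
  have : \det (B *m block_mx 1%:M 0 (- Ap) 1%:M) = \det B.
    by rewrite det_mulmx det_lblock !det1 !mulr1.
  rewrite mulmx_block !mulmx1 !mulmx0 mulmxN mulmxN mul1mx !add0r subrr.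
  rewrite det_ublock det1 mulr1 => <-.
  by rewrite /char_poly /char_poly_mx map_mxM.
have : \det (block_mx (1%:M : 'M[{poly R}]_l) 0 (- Ap) ('X%:M : 'M[{poly R}]_k) *m B) =
    'X^k * \det B.
  by rewrite det_mulmx det_lblock det1 mul1r det_scalar.
rewrite mulmx_block !mul1mx !mul0mx !addr0 mulmx1 !mulNmx.
rewrite scalar_mxC addNr det_ublock det_scalar addrC.
rewrite E1 => e; rewrite mulrC -e mulrC; congr (_ * _).
by rewrite /char_poly /char_poly_mx map_mxM.
Qed.

Lemma char_poly_spectral k (V : 'M[R]_k) (d : 'rV[R]_k) : V^T *m V = 1%:M ->
  char_poly (V *m diag_mx d *m V^T) =
  \prod_(a <- [seq d ord0 i | i <- index_enum 'I_k]) ('X - a%:P).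
Proof.
move=> VV; apply: (mulIf (monic_neq0 (monicXn _ k))).
rewrite char_poly_mulmxC mulmxA VV mul1mx char_poly_trig ?diag_mx_is_trig//.
by rewrite big_map; congr (_ * _); apply: eq_bigr => i _; rewrite mxE eqxx mulr1n.
Qed.

Lemma eigenvaluesP k (K : 'M[R]_k) : K^T = K ->
  char_poly K = \prod_(a <- eigenvalues K) ('X - a%:P).
Proof.
move=> symK; apply: (@xgetPex _ [::] [set s | char_poly K = \prod_(a <- s) ('X - a%:P)]).
have [Q [d [QQ ->]]] := spectral_decomposition symK.
by eexists; exact: char_poly_spectral.
Qed.

Lemma mulX_cancel (p q : {poly R}) a b : p.[0] != 0 -> q.[0] != 0 ->
  p * 'X^a = q * 'X^b -> p = q.
Proof.
wlog: p q a b / (a <= b)%N => [hw p0 q0 e|].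
  case: (leqP a b) => [/hw|/ltnW/hw]; [exact|by move=> h; apply/esym/h].
move=> ab p0 q0; rewrite -(subnK ab) exprD mulrA.
move/(mulIf (monic_neq0 (monicXn _ a))) => pE.
move: p0; rewrite pE; case: (b - a)%N => [|c]; first by rewrite expr0 mulr1.
by rewrite exprS hornerM hornerM hornerX mul0r mulr0 eqxx.
Qed.

Lemma char_poly_at0 k (A : 'M[R]_k) : (char_poly A).[0] = (-1) ^+ k * \det A.
Proof.
by rewrite horner_coef0 char_poly_det.
Qed.

(** By the previous identity the characteristic polynomials of [Z T Z^T] and of the invertible
    matrix [T (Z^T Z)] agree up to powers of [X]. Dividing out the zero roots makes them equal, and
    the constant coefficients give the two determinants. *)
Lemma pdet_congr l k (Z : 'M[R]_(l, k)) (T : 'M[R]_k) :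
  T^T = T -> Z^T *m Z \in unitmx -> T \in unitmx ->
  pdet (Z *m T *m Z^T) = \det (Z^T *m Z) * \det T.
Proof.
move=> symT uZ uT; set K := Z *m T *m Z^T.
have symK : K^T = K by rewrite /K !trmx_mul trmxK symT mulmxA.
pose B := T *m (Z^T *m Z).
have detB : \det B = \det (Z^T *m Z) * \det T by rewrite det_mulmx mulrC.
have detB0 : \det B != 0 by rewrite -unitfE -unitmxE unitmx_mul uT.
have E : char_poly K * 'X^k = char_poly B * 'X^l.
  by rewrite /K -mulmxA char_poly_mulmxC /B mulmxA.
have eK := eigenvaluesP symK; rewrite /pdet; set s := eigenvalues K in eK *.
have sE : \prod_(a <- s) ('X - a%:P) =
    \prod_(a <- s | a != 0) ('X - a%:P) * 'X^(count (pred1 0) s).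
  elim: s {eK} => [|a s IH]; first by rewrite !big_nil expr0 mulr1.
  rewrite !big_cons IH /=; case: eqVneq => [->|a0] /=.
    by rewrite subr0 exprS mulrCA.
  by rewrite mulrA.
have p0 : (\prod_(a <- s | a != 0) ('X - a%:P)).[0] != 0.
  rewrite horner_prod prodf_seq_neq0; apply/allP => a _; apply/implyP => a0.
  by rewrite hornerXsubC sub0r oppr_eq0.
have pB : \prod_(a <- s | a != 0) ('X - a%:P) = char_poly B.
  apply: (@mulX_cancel _ _ (count (pred1 0) s + k) l) => //.
    by rewrite char_poly_at0 mulf_neq0// expf_neq0// oppr_eq0 oner_eq0.
  by rewrite exprD mulrA -sE -eK.
(* Comparing degrees counts the nonzero eigenvalues, so that the signs of the two constant
   coefficients agree. *)
have szk : count (fun a => a != 0) s = k.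
  have := congr1 (fun p : {poly R} => size p) pB.
  by rewrite /= size_char_poly -big_filter size_prod_XsubC size_filter => -[].
have := congr1 (fun p : {poly R} => p.[0]) pB.
rewrite /= char_poly_at0 horner_prod detB; move: (_ * \det T) => D; rewrite -szk.
under eq_bigr do rewrite hornerXsubC sub0r.
rewrite -[in LHS]big_filter -[\prod_(a <- s | _) _]big_filter -size_filter.
move: [seq a <- s | a != 0] => t.
have -> : \prod_(a <- t) - a = (-1) ^+ size t * \prod_(a <- t) a.
  elim: t => [|a t IH]; first by rewrite !big_nil mulr1.
  by rewrite !big_cons IH /= exprS; ring.
by move=> /mulfI; apply; rewrite expf_neq0// oppr_eq0 oner_eq0.
Qed.

End PseudoInverse.

(** * Existence of the orthonormal basis chosen by [orthobasis] *)

Section Orthobasis.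
Variable R : realType.

(** The rows of [row_base K] become orthonormal after division by a factor [M] of their Gram matrix.
    Symmetry of [K] turns its row space into its image. *)
Lemma orthobasisP k (K : 'M[R]_k) : K^T = K ->
  (orthobasis K)^T *m orthobasis K = 1%:M /\
  range (fun u : 'cV[R]_(\rank K) => orthobasis K *m u) = mximage K.
Proof.
move=> symK; pose T := row_base K.
have fT : row_free T by exact: row_base_free.
have [D TD] : exists D, T = D *m K by apply/submxP; rewrite eq_row_base.
have [E KE] : exists E, K = E *m T by apply/submxP; rewrite eq_row_base.
clearbody T.
have Tinj (v : 'cV[R]_(\rank K)) : T^T *m v = 0 -> v = 0.
  move=> Tv; apply/eqP; rewrite -trmx_eq0; apply/eqP.
  apply: (row_free_inj fT); rewrite mul0mx.
  by rewrite -[LHS]trmxK trmx_mul trmxK Tv trmx0.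
have /posdef_factor[M uM ME] : posdef (T *m T^T).
  by have := posdef_gram Tinj; rewrite trmxK.
pose W := T^T *m (invmx M)^T.
have uMT : (invmx M)^T \in unitmx by rewrite unitmx_tr unitmx_inv.
apply: (@xgetPex _ 0 [set W : 'M[R]_(k, \rank K) | W^T *m W = 1%:M /\
   range (fun u : 'cV[R]_(\rank K) => W *m u) = mximage K]).
exists W; split.
  rewrite /W trmx_mul !trmxK !mulmxA -(mulmxA _ T) ME mulmxA mulVmx// mul1mx.
  by rewrite -trmx_mul mulVmx// trmx1.
apply/seteqP; split=> [_ [u _ <-]|_ [v _ <-]].
  exists (D^T *m ((invmx M)^T *m u)) => //.
  by rewrite /W TD trmx_mul symK !mulmxA.
exists (invmx (invmx M)^T *m (E^T *m v)) => //.
by rewrite /W -mulmxA (mulKVmx uMT) mulmxA -trmx_mul -KE symK.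
Qed.

End Orthobasis.

(** * Lebesgue measure and Gaussian integrals *)

Section ChangeOfVariables.
Variable R : realType.
Local Notation mu := (@lebesgue_measure R).

Lemma measurable_cV_mulmx k l (M : 'M[R]_(l, k)) :
  measurable_fun [set: 'cV[R]_k] (fun v => M *m v).
Proof.
apply/measurable_fun_cVP => i; rewrite /comp /cV_coord.
under eq_fun do rewrite mxE.
apply: measurable_sum => j; apply: measurable_funM => //.
exact: (@measurable_cV_coord R k j).
Qed.

Lemma measurable_cV_add k d (T : measurableType d) (f g : T -> 'cV[R]_k) :
  measurable_fun setT f -> measurable_fun setT g ->
  measurable_fun setT (fun x => f x + g x).
Proof.
move=> /measurable_fun_cVP mf /measurable_fun_cVP mg.
apply/measurable_fun_cVP => i.
rewrite (_ : _ \o _ = (cV_coord i \o f) \+ (cV_coord i \o g)).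
  exact: measurable_funD.
by apply/funext => x; rewrite /= /cV_coord mxE.
Qed.

Lemma measurable_cV_opp k d (T : measurableType d) (f : T -> 'cV[R]_k) :
  measurable_fun setT f -> measurable_fun setT (fun x => - f x).
Proof.
move=> /measurable_fun_cVP mf; apply/measurable_fun_cVP => i.
rewrite (_ : _ \o _ = \- (cV_coord i \o f)).
  exact: measurableT_comp.
by apply/funext => x; rewrite /= /cV_coord mxE.
Qed.

Lemma measurable_cV_affine k l (M : 'M[R]_(l, k)) (b : 'cV[R]_l) :
  measurable_fun [set: 'cV[R]_k] (fun v => M *m v + b).
Proof.
by apply: measurable_cV_add => //; exact: measurable_cV_mulmx.
Qed.

Lemma cV_consE k (x : R) (v : 'cV[R]_k) :
  cV_cons (x, v) = col_mx x%:M v :> 'cV[R]_(1 + k).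
Proof.
apply/colP => i; rewrite mxE; case: (unliftP ord0 i) => [j ->|->] /=.
  rewrite (_ : lift ord0 j = rshift 1 j); last exact/val_inj.
  by rewrite col_mxEd.
rewrite (_ : ord0 = @lshift 1 k ord0); last exact/val_inj.
by rewrite col_mxEu mxE eqxx.
Qed.

Lemma integral_cV_cons k (f : 'cV[R]_k.+1 -> \bar R) :
  measurable_fun setT f -> (forall v, 0 <= f v)%E ->
  (\int[lebesgue_cV R k.+1]_v f v =
   \int[mu]_x \int[lebesgue_cV R k]_v f (cV_cons (x, v)))%E.
Proof.
move=> mf f0.
have mfc := measurableT_comp mf (@measurable_cV_cons R k).
transitivity (\int[pushforward (mu \x lebesgue_cV R k)%E (@cV_cons R k)]_v f v)%E.
  reflexivity.
rewrite ge0_integral_pushforward//; last exact: measurable_cV_cons.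
rewrite preimage_setT.
rewrite fubini_tonelli1//.
by move=> x; exact: f0.
Qed.

Lemma integral_cV_consC k (f : 'cV[R]_k.+1 -> \bar R) :
  measurable_fun setT f -> (forall v, 0 <= f v)%E ->
  (\int[lebesgue_cV R k.+1]_v f v =
   \int[lebesgue_cV R k]_v \int[mu]_x f (cV_cons (x, v)))%E.
Proof.
move=> mf f0.
have mfc := measurableT_comp mf (@measurable_cV_cons R k).
transitivity (\int[pushforward (mu \x lebesgue_cV R k)%E (@cV_cons R k)]_v f v)%E.
  reflexivity.
rewrite ge0_integral_pushforward//; last exact: measurable_cV_cons.
rewrite preimage_setT fubini_tonelli2//.
by move=> x; exact: f0.
Qed.

(** The pushforward scaled by [|a|] gives every half-open interval its length, hence is the Lebesgue
    measure by uniqueness. *)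
Lemma integral_affine (a b : R) (f : R -> \bar R) : a != 0 ->
  measurable_fun setT f -> (forall x, 0 <= f x)%E ->
  (`|a|%:E * \int[mu]_x f (a * x + b)%R = \int[mu]_x f x)%E.
Proof.
move=> a0 mf f0.
pose phi (x : R) : measurableTypeR R := a * x + b.
have mphi : measurable_fun [set: measurableTypeR R] phi.
  by apply: measurable_funD => //; exact: measurable_funM.
pose pm : {measure set (measurableTypeR R) -> \bar R} :=
  measure_function_pushforward__canonical__measure_function_Measure mu mphi.
pose nu : {measure set (measurableTypeR R) -> \bar R} :=
  mscale (NngNum (normr_ge0 a)) pm.
have -> : (\int[mu]_x f x = \int[nu]_x f x)%E.
  apply: eq_measure_integral => A mA _.
  apply: lebesgue_measure_unique => // _ [[x y]] _ <-.
  change (mu `]x, y] = (`|a|%:E * mu (phi @^-1` `]x, y]))%E).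
  have [a_gt0|a_le0] := ltP 0 a.
    rewrite (_ : phi @^-1` _ = `](x - b) / a, (y - b) / a]%classic); last first.
      apply/seteqP; split => t /=; rewrite /phi !in_itv/= ltr_pdivrMr// ler_pdivlMr//;
      rewrite ltrBlDr lerBrDr (mulrC t); exact: id.
    rewrite !lebesgue_measure_itv/= !lte_fin ltr_pM2r ?invr_gt0// ltrD2r.
    case: ifP => _; last by rewrite mule0.
    rewrite -EFinD -EFinM gtr0_norm//; congr (_%:E); field.
    by rewrite gt_eqF.
  (* A negative slope exchanges the closed and the open end of the interval; the length is
     unaffected. *)
  have a_lt0 : a < 0 by rewrite lt_neqAle a0.
  rewrite (_ : phi @^-1` _ = `[(y - b) / a, (x - b) / a[%classic); last first.
    apply/seteqP; split => t /=; rewrite /phi !in_itv/= ltr_ndivlMr// ler_ndivrMr//;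
    rewrite ltrBlDr lerBrDr (mulrC t) andbC; exact: id.
  rewrite !lebesgue_measure_itv/= !lte_fin ltr_nM2r ?invr_lt0// ltrD2r.
  case: ifP => _; last by rewrite mule0.
  rewrite -EFinD -EFinM ltr0_norm//; congr (_%:E); field.
  by rewrite lt_eqF.
rewrite ge0_integral_mscale//; congr (_ * _)%E.
by rewrite [RHS]ge0_integral_pushforward//= preimage_setT.
Qed.

Lemma measurable_integral_cV_consl k (f : 'cV[R]_k.+1 -> \bar R) :
  measurable_fun setT f -> (forall v, 0 <= f v)%E ->
  measurable_fun setT (fun x => \int[lebesgue_cV R k]_v f (cV_cons (x, v)))%E.
Proof.
move=> mf f0; have mfc := measurableT_comp mf (@measurable_cV_cons R k).
by apply: (measurable_fun_fubini_tonelli_F (f \o @cV_cons R k)) => // x; exact: f0.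
Qed.

Lemma measurable_integral_cV_consr k (f : 'cV[R]_k.+1 -> \bar R) :
  measurable_fun setT f -> (forall v, 0 <= f v)%E ->
  measurable_fun setT (fun v => \int[mu]_x f (cV_cons (x, v)))%E.
Proof.
move=> mf f0; have mfc := measurableT_comp mf (@measurable_cV_cons R k).
by apply: (@measurable_fun_fubini_tonelli_G _ _ _ _ R mu (f \o @cV_cons R k)) => // x; exact: f0.
Qed.

Lemma measurable_cV_consr k (x : R) :
  measurable_fun [set: 'cV[R]_k] (fun v => cV_cons (x, v)).
Proof.
apply: (measurableT_comp (@measurable_cV_cons R k)).
exact: measurable_fun_pair.
Qed.

Lemma measurable_cV_consl k (v : 'cV[R]_k) :
  measurable_fun [set: R] (fun x => cV_cons (x, v)).
Proof.
apply: (measurableT_comp (@measurable_cV_cons R k)).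
exact: measurable_fun_pair.
Qed.

Let affine_spec k := forall (M : 'M[R]_k) (b : 'cV[R]_k) (f : 'cV[R]_k -> \bar R),
  M \in unitmx -> measurable_fun setT f -> (forall v, 0 <= f v)%E ->
  (`|\det M|%:E * \int[lebesgue_cV R k]_v f (M *m v + b)%R =
   \int[lebesgue_cV R k]_v f v)%E.

(** One step of Gaussian elimination. The map is the composite of [(x, v) |-> (a x + e v, v)],
    treated by integrating in [x] first, and of a map that fixes the first coordinate and acts on
    the others by the Schur complement [D'], treated by integrating in [v] first. The shifts [b0]
    and [b1] are split accordingly, whence the correction in [b']. *)
Let affine_pivot k : affine_spec k ->
  forall (M : 'M[R]_(1 + k)) (b : 'cV[R]_(1 + k)) (f : 'cV[R]_k.+1 -> \bar R),
  M \in unitmx -> ulsubmx M ord0 ord0 != 0 ->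
  measurable_fun setT f -> (forall v, 0 <= f v)%E ->
  (`|\det M|%:E * \int[lebesgue_cV R k.+1]_v f (M *m v + b)%R =
   \int[lebesgue_cV R k.+1]_v f v)%E.
Proof.
move=> IH M b f uM; set a := ulsubmx M ord0 ord0 => a0 mf f0.
pose B := ursubmx M; pose C := dlsubmx M; pose D := drsubmx M.
pose D' := D - a^-1 *: (C *m B).
have ME : M = block_mx a%:M B C D.
  by rewrite -[LHS]submxK; congr block_mx; exact: mx11_scalar.
have detM : \det M = a * \det D'.
  have -> : M = block_mx 1%:M 0 (a^-1 *: C) 1%:M *m block_mx a%:M B 0 D'.
    rewrite mulmx_block !mul1mx !mul0mx !addr0 ME; congr block_mx.
      by rewrite mul_mx_scalar scalerA divff// scale1r.
    by rewrite -scalemxAl /D' addrC subrK.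
  by rewrite det_mulmx det_lblock det_ublock !det1 !mul1r det_scalar1.
have uD : D' \in unitmx.
  by rewrite unitmxE unitfE; move: uM; rewrite unitmxE unitfE detM mulf_eq0 negb_or => /andP[].
pose b0 := usubmx b ord0 ord0; pose b1 : 'cV[R]_k := dsubmx b.
pose e (v : 'cV[R]_k) := (B *m v) ord0 ord0 + b0.
pose be (x : R) : 'cV[R]_k := (a^-1 * x) *: C + (b1 - (a^-1 * b0) *: C).
pose M' : 'M[R]_(1 + k) := block_mx 1%:M 0 (a^-1 *: C) D'.
pose b' : 'cV[R]_(1 + k) := col_mx 0 (b1 - (a^-1 * b0) *: C).
have M'E x v : M' *m cV_cons (x, v) + b' = cV_cons (x, D' *m v + be x).
  rewrite !cV_consE mul_block_col mul1mx mul0mx addr0 add_col_mx addr0.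
  congr col_mx; rewrite mul_mx_scalar scalerA (mulrC x) addrAC addrC.
  by rewrite /be addrA.
have ME' x v : M *m cV_cons (x, v) + b = M' *m cV_cons (a * x + e v, v) + b'.
  rewrite M'E !cV_consE ME mul_block_col -[b]vsubmxK add_col_mx; congr col_mx.
    rewrite -scalar_mxM [B *m v]mx11_scalar [usubmx b]mx11_scalar -!raddfD/=.
    by rewrite /e -/b0 addrA.
  rewrite mul_mx_scalar -/b1 /be /D' mulmxBl -scalemxAl -mulmxA [B *m v]mx11_scalar.
  rewrite mul_mx_scalar /e; move: (C) (D *m v) ((B *m v) ord0 ord0) => c d s.
  by apply/colP => i; rewrite !mxE; field.
have mF N (c : 'cV[R]_k.+1) : measurable_fun setT (fun z : 'cV[R]_k.+1 => f (N *m z + c)).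
  by apply: measurableT_comp => //; exact: measurable_cV_affine.
rewrite (integral_cV_consC (mF M b))//.
rewrite detM normrM mulrC EFinM -muleA -ge0_integralZl//; last 2 first.
- exact: (measurable_integral_cV_consr (mF M b)).
- by move=> v _; exact: integral_ge0.
under eq_integral => v _.
  under [X in (_ * X)%E]eq_integral => x _ do rewrite ME'.
  rewrite (@integral_affine a (e v) (fun x => f (M' *m cV_cons (x, v) + b'))) //; last first.
    apply: (measurableT_comp (mF M' b')); exact: measurable_cV_consl.
  over.
rewrite -(integral_cV_consC (mF M' b'))//.
rewrite (integral_cV_cons (mF M' b'))//.
rewrite -ge0_integralZl//; last 2 first.
- exact: (measurable_integral_cV_consl (mF M' b')).
- by move=> v _; exact: integral_ge0.
rewrite integral_cV_cons//; apply: eq_integral => x _.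
under [X in (_ * X)%E]eq_integral => v _ do rewrite M'E.
rewrite (IH D' (be x) (fun v => f (cV_cons (x, v))))//.
by apply: measurableT_comp => //; exact: measurable_cV_consr.
Qed.

Theorem integral_cV_affine k (M : 'M[R]_k) (b : 'cV[R]_k) (f : 'cV[R]_k -> \bar R) :
  M \in unitmx -> measurable_fun setT f -> (forall v, 0 <= f v)%E ->
  (`|\det M|%:E * \int[lebesgue_cV R k]_v f (M *m v + b)%R =
   \int[lebesgue_cV R k]_v f v)%E.
Proof.
elim: k M b f => [|k IH] M b f uM mf f0.
  rewrite det_mx00 normr1 mul1e; apply: eq_integral => v _; congr f.
  by apply/colP => -[].
pose M1 : 'M[R]_(1 + k) := M; pose a := ulsubmx M1 ord0 ord0.
have [a0|a0] := eqVneq a 0; last exact: affine_pivot.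
have [i ci0] : exists i, dlsubmx M1 i ord0 != 0.
  apply/existsP; apply: contraT; rewrite negb_exists => /forallP c0.
  have /(unitmx_mulmx_eq0 uM) : M1 *m col_mx 1%:M 0 = 0 :> 'cV[R]_(1 + k).
    rewrite -[M1]submxK mul_block_col !mulmx1 !mulmx0 !addr0.
    rewrite [ulsubmx M1]mx11_scalar -/a a0 raddf0.
    rewrite (_ : dlsubmx M1 = 0) ?col_mx0//.
    by apply/colP => i; rewrite [RHS]mxE; apply/eqP; have := c0 i; rewrite negbK.
  move=> /(congr1 (fun u : 'cV[R]_(1 + k) => u (lshift k ord0) ord0)).
  rewrite col_mxEu !mxE eqxx => /eqP.
  by rewrite oner_eq0.
(* The shear [S] brings a nonzero entry to the pivot position. *)
pose e : 'rV[R]_k := delta_mx ord0 i.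
pose S : 'M[R]_(1 + k) := block_mx 1%:M e 0 1%:M.
pose S' : 'M[R]_(1 + k) := block_mx 1%:M (- e) 0 1%:M.
have S'S : S' *m S = 1%:M.
  rewrite mulmx_block !mulmx1 !mul1mx !mul0mx !mulmx0 !addr0 !add0r subrr.
  by rewrite -scalar_mx_block.
have [uS' uS] := mulmx1_unit S'S.
have dS : \det S = 1 by rewrite det_ublock !det1 mulr1.
have dS' : \det S' = 1 by rewrite det_ublock !det1 mulr1.
have mF : measurable_fun setT (fun v : 'cV[R]_k.+1 => f (S' *m v)).
  by apply: measurableT_comp => //; exact: measurable_cV_mulmx.
have uSM : S *m M1 \in unitmx by rewrite unitmx_mul uS.
have pSM : ulsubmx (S *m M1) ord0 ord0 != 0.
  rewrite -[M1]submxK mulmx_block block_mxKul mul1mx mxE -/a a0 add0r.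
  by rewrite -rowE mxE.
(* The pivot case is used twice: for [S M] with the integrand composed with [S'], and for [S']
   itself, whose pivot is 1. Both shears have determinant 1. *)
have := @affine_pivot k IH (S *m M1) (S *m b) _ uSM pSM mF (fun v => f0 _).
rewrite det_mulmx dS mul1r => e1.
have pS' : ulsubmx S' ord0 ord0 != 0 by rewrite block_mxKul mxE eqxx oner_eq0.
have := @affine_pivot k IH S' 0 f uS' pS' mf f0.
rewrite dS' normr1 mul1e => <-.
under [RHS]eq_integral do rewrite addr0.
rewrite -[RHS]e1; congr (_ * _)%E; apply: eq_integral => v _; congr f.
by rewrite -mulmxA -mulmxDr mulmxA S'S mul1mx.
Qed.

End ChangeOfVariables.

(** * Mass and second moment of the one-dimensional normal density *)

Section StandardNormal.
Variable R : realType.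
Local Notation mu := (@lebesgue_measure R).

Definition normal1 (x : R) : R :=
  (Num.sqrt (2 * pi))^-1 * expR (- (1 / 2) * x ^+ 2).

Lemma normal1E : normal1 = normal_pdf 0 1.
Proof.
apply/funext => x; rewrite normal_pdfE ?oner_eq0// /normal_peak /normal_fun.
rewrite /normal1 expr1n mul1r subr0; congr (_^-1 * expR _).
  by rewrite mul1r mulr_natl.
by field.
Qed.

Lemma normal1_ge0 x : 0 <= normal1 x.
Proof. by rewrite normal1E normal_pdf_ge0. Qed.

Lemma measurable_normal1 : measurable_fun setT normal1.
Proof. by rewrite normal1E; exact: measurable_normal_pdf. Qed.

Lemma integral_normal1 : (\int[mu]_x (normal1 x)%:E = 1)%E.
Proof. by rewrite normal1E integral_normal_pdf// oner_eq0. Qed.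

Lemma integral_normal1_scale (a : R) : 0 < a ->
  (\int[mu]_x (normal1 (a * x))%:E = a^-1%:E)%E.
Proof.
move=> a0; have a0' : a != 0 by rewrite gt_eqF.
have := @integral_affine R a 0 (EFin \o normal1) a0'.
rewrite integral_normal1 gtr0_norm// => h.
have {}h : (a%:E * \int[mu]_x (normal1 (a * x))%:E = 1)%E.
  rewrite -[RHS]h; last 2 first.
  - by apply/measurable_EFinP; exact: measurable_normal1.
  - by move=> x; rewrite lee_fin normal1_ge0.
  - by congr (_ * _)%E; apply: eq_integral => x _ /=; rewrite addr0.
have := congr1 (fun x => a^-1%:E * x)%E h.
by rewrite muleA -EFinM mulVf// mul1e mule1.
Qed.

(* Since [1 + y <= expR y], integrating
   [normal1 x * (1 + (1 - a^2) / 2 * x^2) <= normal1 (a x)] bounds the second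
   moment by [2 / (a (1 + a))] from above for [a < 1], from below for [a > 1]. *)
Lemma integral_normal1_sqr : (\int[mu]_x (x ^+ 2 * normal1 x)%:E = 1)%E.
Proof.
have msq : measurable_fun setT (fun x : R => (x ^+ 2 * normal1 x)%:E).
  apply/measurable_EFinP/measurable_funM; first exact: measurable_funX.
  exact: measurable_normal1.
have sq0 (x : R) : (0 <= (x ^+ 2 * normal1 x)%:E)%E.
  by rewrite lee_fin mulr_ge0 ?sqr_ge0 ?normal1_ge0.
have m1 a : measurable_fun setT (fun x : R => (normal1 (a * x))%:E).
  apply/measurable_EFinP/(measurableT_comp measurable_normal1).
  exact: measurable_funM.
have tangent a x : normal1 x * (1 + (1 - a ^+ 2) / 2 * x ^+ 2) <= normal1 (a * x).
  rewrite /normal1 -(mulrA _ (expR _)) ler_pM2l ?invr_gt0 ?sqrtr_gt0 ?mulr_gt0 ?pi_gt0//.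
  have -> : - (1 / 2) * (a * x) ^+ 2 =
      - (1 / 2) * x ^+ 2 + (1 - a ^+ 2) / 2 * x ^+ 2 by field.
  by rewrite expRD ler_pM2l ?expR_gt0// expR_ge1Dx.
set J := (\int[mu]_x _)%E.
have J0 : (0 <= J)%E by apply: integral_ge0 => x _; exact: sq0.
have up a : 0 < a < 1 -> (((1 - a ^+ 2) / 2)%:E * J + 1 <= a^-1%:E)%E.
  move=> /andP[a0 a1]; rewrite -integral_normal1_scale// -integral_normal1.
  have c0 : 0 <= (1 - a ^+ 2) / 2 by nra.
  rewrite -ge0_integralZl// -ge0_integralD//; last 4 first.
  - by move=> x _; rewrite mule_ge0.
  - exact: measurable_funeM.
  - by move=> x _; rewrite lee_fin normal1_ge0.
  - by apply/measurable_EFinP; exact: measurable_normal1.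
  apply: ge0_le_integral => //.
  - move=> x _; rewrite -EFinM -EFinD lee_fin addr_ge0 ?normal1_ge0//.
    by apply: mulr_ge0 => //; rewrite mulr_ge0 ?sqr_ge0 ?normal1_ge0.
  - apply: emeasurable_funD; first exact: measurable_funeM.
    by apply/measurable_EFinP; exact: measurable_normal1.
  - exact: m1.
  move=> x _; rewrite -EFinM -EFinD lee_fin; have := tangent a x.
  by lra.
have Jfin : J \is a fin_num.
  rewrite ge0_fin_numE// ltNge leye_eq; apply/negP => /eqP Joo.
  have := up (1 / 2); rewrite Joo gt0_muley ?lte_fin; last by lra.
  by rewrite addye// leye_eq /= => /(_ ltac:(lra)).
have lo a : 1 < a -> (1 <= a^-1%:E + ((a ^+ 2 - 1) / 2)%:E * J)%E.
  move=> a1; have a0 : 0 < a by lra.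
  have c0 : 0 <= (a ^+ 2 - 1) / 2 by nra.
  rewrite -integral_normal1_scale// -integral_normal1 -ge0_integralZl//.
  rewrite -ge0_integralD//; last 4 first.
  - by move=> x _; rewrite lee_fin normal1_ge0.
  - exact: m1.
  - by move=> x _; rewrite mule_ge0.
  - exact: measurable_funeM.
  apply: ge0_le_integral => //.
  - by move=> x _; rewrite lee_fin normal1_ge0.
  - by apply/measurable_EFinP; exact: measurable_normal1.
  - by apply: emeasurable_funD; [exact: m1|exact: measurable_funeM].
  move=> x _; rewrite -EFinM -EFinD lee_fin; have := tangent a x.
  by lra.
move: J0 up lo; rewrite -(fineK Jfin); move: (fine J) => j j0 up lo.
rewrite lee_fin in j0; congr (_%:E).
have {}up a : 0 < a < 1 -> a * (1 + a) * j <= 2.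
  move=> a01; have /andP[a0 a1] := a01.
  have := up a a01; rewrite -EFinM -EFinD lee_fin.
  rewrite -(ler_pM2l a0) divff ?gt_eqF// => h.
  have : (1 - a) * (a * (1 + a) * j) <= (1 - a) * 2 by lra.
  by rewrite ler_pM2l// subr_gt0.
have {}lo a : 1 < a -> 2 <= a * (1 + a) * j.
  move=> a1; have a0 : 0 < a by lra.
  have := lo a a1; rewrite -EFinM -EFinD lee_fin.
  rewrite -(ler_pM2l a0) mulrDr divff ?gt_eqF// => h.
  have : (a - 1) * 2 <= (a - 1) * (a * (1 + a) * j) by lra.
  by rewrite ler_pM2l// subr_gt0.
apply/eqP; rewrite eq_le; apply/andP; split.
  rewrite leNgt; apply/negP => j1.
  (* For [a = 1 - e] the upper bound reads [2 j - 3 e j + e^2 j <= 2]. This [e] turns the left side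
     into [j + 1 + e^2 j], which exceeds 2. *)
  pose e := (j - 1) / (3 * j).
  have j3 : e * (3 * j) = j - 1 by rewrite /e divfK// gt_eqF//; lra.
  have e0 : 0 < e by rewrite divr_gt0; lra.
  have e1 : e < 1 by nra.
  have := up (1 - e) ltac:(lra); nra.
rewrite leNgt; apply/negP => j1.
(* With [a = 1 + d] the lower bound reads [2 <= (2 + 3 d + d^2) j]. For [d = (1 - j) / 4] one has
   [3 d + d^2 <= 4 d], so the right side stays below [2 j + 2 (1 - j)]. *)
have := lo (1 + (1 - j) / 4) ltac:(lra); nra.
Qed.

End StandardNormal.

(** * Product structure of the standard Gaussian density *)

Section GaussianIntegrals.
Variable R : realType.
Local Notation mu := (@lebesgue_measure R).

Lemma measurable_cV_quad k (X : 'M[R]_k) d (T : measurableType d) (f : T -> 'cV[R]_k) :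
  measurable_fun setT f ->
  measurable_fun setT (fun x => ((f x)^T *m X *m f x) ord0 ord0).
Proof.
move=> /measurable_fun_cVP mf.
rewrite (_ : (fun _ => _) =
    fun x => \sum_i (\sum_j f x j ord0 * X j i) * f x i ord0); last first.
  apply/funext => x; rewrite mxE; apply: eq_bigr => i _; rewrite mxE.
  by congr (_ * _); apply: eq_bigr => j _; rewrite mxE.
apply: measurable_sum => i; apply: measurable_funM; last exact: (mf i).
apply: measurable_sum => j; apply: measurable_funM => //; exact: (mf j).
Qed.

Lemma measurable_sqnorm k d (T : measurableType d) (f : T -> 'cV[R]_k) :
  measurable_fun setT f -> measurable_fun setT (fun x => sqnorm (f x)).
Proof.
move=> mf; under eq_fun do rewrite -sqnormE -[(f _)^T]mulmx1.
exact: measurable_cV_quad.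
Qed.

Definition std_density k (v : 'cV[R]_k) : R :=
  (Num.sqrt ((2 * pi) ^+ k))^-1 * expR (- (1 / 2) * sqnorm v).

Definition gauss_density k (m : 'cV[R]_k) (S : 'M[R]_k) (u : 'cV[R]_k) : R :=
  (Num.sqrt ((2 * pi) ^+ k * \det S))^-1 *
  expR (- (1 / 2) * ((u - m)^T *m invmx S *m (u - m)) ord0 ord0).

Lemma std_density_ge0 k (v : 'cV[R]_k) : 0 <= std_density v.
Proof. by rewrite mulr_ge0 ?invr_ge0 ?sqrtr_ge0 ?expR_ge0. Qed.

Lemma gauss_density_ge0 k m S (u : 'cV[R]_k) : 0 <= gauss_density m S u.
Proof. by rewrite mulr_ge0 ?invr_ge0 ?sqrtr_ge0 ?expR_ge0. Qed.

Lemma gauss_density_gt0 k m S (u : 'cV[R]_k) : posdef S -> 0 < gauss_density m S u.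
Proof.
move=> pS; rewrite mulr_gt0 ?expR_gt0// invr_gt0 sqrtr_gt0 mulr_gt0//.
  by rewrite exprn_gt0// mulr_gt0// pi_gt0.
exact: posdef_det_gt0.
Qed.

Lemma measurable_std_density k : measurable_fun setT (@std_density k).
Proof.
apply: measurable_funM => //; apply: measurableT_comp => //.
by apply: measurable_funM => //; exact: measurable_sqnorm.
Qed.

Lemma measurable_gauss_density k m S : measurable_fun setT (@gauss_density k m S).
Proof.
apply: measurable_funM => //; apply: measurableT_comp => //.
apply: measurable_funM => //; apply: measurable_cV_quad.
exact: measurable_cV_add.
Qed.

Lemma sqnorm_cons k x (v : 'cV[R]_k) : sqnorm (cV_cons (x, v)) = x ^+ 2 + sqnorm v.
Proof.
rewrite /sqnorm big_ord_recl mxE unlift_none; congr (_ + _).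
by apply: eq_bigr => i _; rewrite mxE liftK.
Qed.

Lemma std_density_cons k x (v : 'cV[R]_k) :
  std_density (cV_cons (x, v)) = normal1 x * std_density v.
Proof.
rewrite /std_density /normal1 sqnorm_cons (mulrDr (- (1 / 2))) expRD exprS.
rewrite sqrtrM ?invfM; last by rewrite mulr_ge0// pi_ge0.
ring.
Qed.

Lemma integral_std_density k :
  (\int[lebesgue_cV R k]_v (std_density v)%:E = 1)%E.
Proof.
have m k' : measurable_fun setT (EFin \o @std_density k').
  by apply/measurable_EFinP; exact: measurable_std_density.
elim: k => [|k IH].
  rewrite (_ : (fun v : 'cV[R]_0 => _) = cst 1%E).
    by rewrite /= integral_dirac// diracT mule1.
  apply/funext => v; rewrite /std_density /sqnorm big_ord0 mulr0 expR0 expr0.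
  by rewrite sqrtr1 invr1 mulr1.
rewrite (integral_cV_cons (m _)); last by move=> v; rewrite lee_fin std_density_ge0.
rewrite -integral_normal1; apply: eq_integral => x _ /=.
under eq_integral do rewrite std_density_cons EFinM.
rewrite ge0_integralZl_EFin ?normal1_ge0//; last 2 first.
- by move=> v _; rewrite lee_fin std_density_ge0.
- exact: m.
by rewrite IH mule1.
Qed.

(** The marginal laws of the standard Gaussian; a nonnegative [h] lets Tonelli's theorem apply
    without integrability. *)
Lemma integral_std_density_coord k (i : 'I_k) (h : R -> R) :
  measurable_fun setT h -> (forall x, 0 <= h x) ->
  (\int[lebesgue_cV R k]_v (h (v i ord0) * std_density v)%:E =
   \int[mu]_x (h x * normal1 x)%:E)%E.
Proof.
move=> mh h0.
have mhk k' (j : 'I_k') : measurable_fun setT (fun v : 'cV[R]_k' => h (v j ord0)).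
  by apply: (measurableT_comp mh); exact: (@measurable_cV_coord R k' j).
have m k' (j : 'I_k') : measurable_fun setT
    (fun v : 'cV[R]_k' => (h (v j ord0) * std_density v)%:E).
  by apply/measurable_EFinP/measurable_funM; [exact: mhk|exact: measurable_std_density].
have ge0 k' (j : 'I_k') (v : 'cV[R]_k') : (0 <= (h (v j ord0) * std_density v)%:E)%E.
  by rewrite lee_fin mulr_ge0 ?std_density_ge0.
elim: k i => [[]//|k IH] i.
rewrite (integral_cV_cons (m _ i)) => [|v]; last exact: (ge0 _ i v).
have [j ->|->] := unliftP ord0 i; last first.
  apply: eq_integral => x _.
  under eq_integral do rewrite std_density_cons mxE unlift_none/= mulrA EFinM.
  rewrite ge0_integralZl_EFin ?mulr_ge0 ?normal1_ge0//.
  - by rewrite integral_std_density mule1.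
  - by move=> v _; rewrite lee_fin std_density_ge0.
  - by apply/measurable_EFinP; exact: measurable_std_density.
have inner x : (\int[lebesgue_cV R k]_v
      (h (cV_cons (x, v) (lift ord0 j) ord0) * std_density (cV_cons (x, v)))%:E =
    \int[mu]_y (h y * normal1 y)%:E * (normal1 x)%:E)%E.
  under eq_integral do rewrite std_density_cons mxE liftK/= mulrCA EFinM.
  rewrite ge0_integralZl_EFin ?normal1_ge0//; last exact: (m _ j).
  by rewrite IH muleC.
under eq_integral do rewrite inner.
rewrite ge0_integralZl//.
- by rewrite integral_normal1 mule1.
- by apply/measurable_EFinP; exact: measurable_normal1.
- by move=> x _; rewrite lee_fin normal1_ge0.
- by apply: integral_ge0 => x _; rewrite lee_fin mulr_ge0 ?normal1_ge0.
Qed.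

(** The reflection [x |-> - x] exchanges the integrals for [t] and [- t]. In their sum the cross
    term cancels pointwise, so the first moment never has to be integrated. *)
Lemma integral_normal1_shift_sqr (t : R) :
  (\int[mu]_x ((x + t) ^+ 2 * normal1 x)%:E = (1 + t ^+ 2)%:E)%E.
Proof.
have m1 : measurable_fun setT (EFin \o @normal1 R).
  by apply/measurable_EFinP; exact: measurable_normal1.
have m c : measurable_fun setT (fun x : R => ((x + c) ^+ 2 * normal1 x)%:E).
  apply/measurable_EFinP/measurable_funM; last exact: measurable_normal1.
  by apply: measurable_funX; exact: measurable_funD.
have m2 : measurable_fun setT (fun x : R => (x ^+ 2 * normal1 x)%:E).
  by have := m 0; under eq_fun do rewrite addr0.
have ge0 (c x : R) : (0 <= ((x + c) ^+ 2 * normal1 x)%:E)%E.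
  by rewrite lee_fin mulr_ge0 ?sqr_ge0 ?normal1_ge0.
have ge02 (x : R) : (0 <= (x ^+ 2 * normal1 x)%:E)%E.
  by rewrite lee_fin mulr_ge0 ?sqr_ge0 ?normal1_ge0.
have ge01 (x : R) : (0 <= (normal1 x)%:E)%E by rewrite lee_fin normal1_ge0.
have sym : (\int[mu]_x ((x + t) ^+ 2 * normal1 x)%:E =
    \int[mu]_x ((x - t) ^+ 2 * normal1 x)%:E)%E.
  have := @integral_affine R (-1) 0 _ _ (m t) (ge0 t).
  rewrite oppr_eq0 oner_eq0 normrN1 mul1e => /(_ isT) <-.
  apply: eq_integral => x _; rewrite /normal1 addr0 mulN1r sqrrN.
  by rewrite (_ : (- x + t) ^+ 2 = (x - t) ^+ 2)//; ring.
have : (\int[mu]_x ((x + t) ^+ 2 * normal1 x)%:E +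
    \int[mu]_x ((x + t) ^+ 2 * normal1 x)%:E = (2 * (1 + t ^+ 2))%:E)%E.
  rewrite {2}sym -ge0_integralD//; last 2 first.
  - exact: m.
  - exact: m.
  transitivity (\int[mu]_x (2%:E * (x ^+ 2 * normal1 x)%:E +
      (2 * t ^+ 2)%:E * (normal1 x)%:E))%E.
    apply: eq_integral => x _; rewrite -EFinD -!EFinM -EFinD; congr (_%:E); ring.
  have t0 : 0 <= 2 * t ^+ 2 by rewrite mulr_ge0 ?sqr_ge0.
  rewrite ge0_integralD//.
  - rewrite ge0_integralZl_EFin// ge0_integralZl_EFin//.
    by rewrite integral_normal1 integral_normal1_sqr !mule1 -EFinD mulrDr mulr1.
  - by move=> x _; rewrite mule_ge0.
  - exact: measurable_funeM.
  - by move=> x _; rewrite mule_ge0.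
  - exact: measurable_funeM.
set J := (\int[mu]_x _)%E.
case: J => [j|//|//].
rewrite -EFinD => -[] h.
by congr (_%:E); lra.
Qed.

End GaussianIntegrals.

(** * Moments of a nondegenerate Gaussian density *)

Section GaussianMoments.
Variable R : realType.

Lemma gauss_density_std k (M : 'M[R]_k) (m w : 'cV[R]_k) : M \in unitmx ->
  `|\det M| * gauss_density m (M *m M^T) (M *m w + m) = std_density w.
Proof.
move=> uM; have dM : \det M != 0 by rewrite -unitfE -unitmxE.
rewrite /gauss_density /std_density addrK mulrA; congr (_ * expR (_ * _)).
  rewrite det_mulmx det_tr -expr2 sqrtrM; last first.
    by rewrite exprn_ge0// mulr_ge0// pi_ge0.
  by rewrite sqrtr_sqr invfM mulrCA divff ?mulr1// normr_eq0.
rewrite -sqnormE trmx_mul; congr ((_ : 'M[R]_1) ord0 ord0).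
have uMM : M *m M^T \in unitmx by rewrite unitmx_mul unitmx_tr uM.
suff -> : invmx (M *m M^T) = (invmx M)^T *m invmx M.
  rewrite !mulmxA -(mulmxA _ M^T) -trmx_mul mulVmx// trmx1 mulmx1 -mulmxA.
  by rewrite -(mulmxA w^T) mulKmx.
apply: (can_inj (mulKmx uMM)); rewrite mulmxV// mulmxA -(mulmxA M).
by rewrite -trmx_mul mulVmx// trmx1 mulmx1 mulmxV.
Qed.

Lemma integral_gauss_std k (M : 'M[R]_k) (m : 'cV[R]_k) (f : 'cV[R]_k -> R) :
  M \in unitmx -> measurable_fun setT f -> (forall v, 0 <= f v) ->
  (\int[lebesgue_cV R k]_v (f v * gauss_density m (M *m M^T) v)%:E =
   \int[lebesgue_cV R k]_w (f (M *m w + m)%R * std_density w)%:E)%E.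
Proof.
move=> uM mf f0.
have mg : measurable_fun setT (fun v => (f v * gauss_density m (M *m M^T) v)%:E).
  apply/measurable_EFinP/measurable_funM => //; exact: measurable_gauss_density.
have g0 v : (0 <= (f v * gauss_density m (M *m M^T) v)%:E)%E.
  by rewrite lee_fin mulr_ge0 ?gauss_density_ge0.
rewrite -(@integral_cV_affine _ _ M m _ uM mg g0) -ge0_integralZl//.
- by apply: eq_integral => w _; rewrite -EFinM -(gauss_density_std m w uM); congr (_%:E); ring.
- exact: (measurableT_comp mg (measurable_cV_affine M m)).
Qed.

Lemma integral_gauss_density k (m : 'cV[R]_k) (S : 'M[R]_k) : posdef S ->
  (\int[lebesgue_cV R k]_v (gauss_density m S v)%:E = 1)%E.
Proof.
move=> /posdef_factor[M uM ->].
have := @integral_gauss_std _ M m (cst 1) uM (measurable_cst _) (fun=> ler01).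
under eq_integral do rewrite mul1r; move=> ->.
by under eq_integral do rewrite mul1r; exact: integral_std_density.
Qed.

(** After the substitution [v = M w + m], with [M] diagonalizing [S] and [X] together, the form
    becomes the sum of [d_i (w_i + c_i)^2] for a standard Gaussian [w], where [M c = m - u]; here
    [\tr (X S)] is the sum of the [d_i]. *)
Lemma integral_gauss_quad k (m u : 'cV[R]_k) (S X : 'M[R]_k) :
  posdef S -> psd X ->
  (\int[lebesgue_cV R k]_v
     (((v - u)^T *m X *m (v - u)) ord0 ord0 * gauss_density m S v)%:E =
   (\tr (X *m S) + ((m - u)^T *m X *m (m - u)) ord0 ord0)%:E)%E.
Proof.
move=> pS pX; have [M [d [uM SE XE]]] := posdef_codiag pS pX.1.
have d0 i : 0 <= d ord0 i.
  have := (psd_congr M pX).2 (delta_mx i ord0); rewrite XE.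
  by rewrite trmx_delta -rowE row_diag_mx -scalemxAl mul_delta_mx !mxE !eqxx mulr1.
pose c := invmx M *m (m - u).
have mE : m - u = M *m c by rewrite mulKVmx.
clearbody c.
have quadE w : ((M *m w)^T *m X *m (M *m w)) ord0 ord0 =
    \sum_i d ord0 i * (w i ord0) ^+ 2.
  rewrite trmx_mul !mulmxA -(mulmxA _ _ X) -(mulmxA _ _ M) XE mxE.
  apply: eq_bigr => i _; rewrite mul_mx_diag !mxE expr2; ring.
have mX : measurable_fun setT (fun v : 'cV[R]_k => ((v - u)^T *m X *m (v - u)) ord0 ord0).
  by apply: measurable_cV_quad; exact: measurable_cV_add.
rewrite SE integral_gauss_std//; last by move=> v; exact: pX.2.
have mi i : measurable_fun setT (fun w : 'cV[R]_k =>
    ((w i ord0 + c i ord0) ^+ 2 * std_density w)%:E).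
  apply/measurable_EFinP/measurable_funM; last exact: measurable_std_density.
  apply: measurable_funX; apply: measurable_funD => //.
  exact: (@measurable_cV_coord R k i).
have ge0 i (w : 'cV[R]_k) : (0 <= ((w i ord0 + c i ord0) ^+ 2 * std_density w)%:E)%E.
  by rewrite lee_fin mulr_ge0 ?sqr_ge0 ?std_density_ge0.
transitivity (\int[lebesgue_cV R k]_w \sum_(i < k)
    ((d ord0 i)%:E * ((w i ord0 + c i ord0) ^+ 2 * std_density w)%:E))%E.
  apply: eq_integral => w _.
  rewrite -addrA mE -mulmxDr quadE mulr_suml -sumEFin.
  by apply: eq_bigr => i _; rewrite -EFinM -mulrA !mxE.
rewrite ge0_integral_sum//; last 2 first.
- by move=> i; apply: measurable_funeM; exact: mi.
- by move=> i w _; apply: mule_ge0; [rewrite lee_fin|exact: (ge0 i w)].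
rewrite mE quadE; have -> : \tr (X *m (M *m M^T)) = \sum_i d ord0 i.
  by rewrite mulmxA mxtrace_mulC mulmxA XE mxtrace_diag.
rewrite -big_split/= -sumEFin; apply: eq_bigr => i _.
rewrite ge0_integralZl_EFin//.
rewrite (@integral_std_density_coord _ _ i (fun x => (x + c i ord0) ^+ 2)); last 2 first.
- by apply: measurable_funX; exact: measurable_funD.
- by move=> x; rewrite sqr_ge0.
by rewrite integral_normal1_shift_sqr -EFinM mulrDr mulr1.
Qed.

Lemma integrable_gauss_quad k (m u : 'cV[R]_k) (S X : 'M[R]_k) :
  posdef S -> psd X ->
  (lebesgue_cV R k).-integrable setT
    (fun v => (((v - u)^T *m X *m (v - u)) ord0 ord0 * gauss_density m S v)%:E).
Proof.
move=> pS pX; apply/integrableP; split.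
  apply/measurable_EFinP/measurable_funM; last exact: measurable_gauss_density.
  by apply: measurable_cV_quad; exact: measurable_cV_add.
under eq_integral do rewrite gee0_abs ?lee_fin ?mulr_ge0 ?gauss_density_ge0 ?pX.2//.
by rewrite integral_gauss_quad// ltry.
Qed.

Lemma integrable_gauss_density k (m : 'cV[R]_k) (S : 'M[R]_k) : posdef S ->
  (lebesgue_cV R k).-integrable setT (EFin \o gauss_density m S).
Proof.
move=> pS; apply/integrableP; split.
  by apply/measurable_EFinP; exact: measurable_gauss_density.
under eq_integral do rewrite gee0_abs ?lee_fin ?gauss_density_ge0//.
by rewrite integral_gauss_density// ltry.
Qed.

End GaussianMoments.

(** * Degenerate Gaussian laws *)

Section SupportCoordinates.
Variables (R : realType) (N k : nat) (Z : 'M[R]_(N, k)).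
Hypothesis uZ : Z^T *m Z \in unitmx.
Implicit Types (m : 'cV[R]_N) (mu s : 'cV[R]_k) (T : 'M[R]_k).

Let Y := Z *m invmx (Z^T *m Z).

Let YZ : Y^T *m Z = 1%:M.
Proof.
by rewrite /Y trmx_mul trmx_inv trmx_mul trmxK -mulmxA mulVmx.
Qed.

Let ZY : Z^T *m Y = 1%:M.
Proof. by rewrite /Y mulmxA mulmxV. Qed.

Let detZ_gt0 : 0 < \det (Z^T *m Z).
Proof.
apply: posdef_det_gt0; apply: posdef_gram => v Zv.
by rewrite -[v]mul1mx -YZ -mulmxA Zv mulmx0.
Qed.

(* The Jacobian of [s |-> m + Z s] with respect to [aff_lebesgue]. *)
Definition support_scale : R := Num.sqrt (\det (Z^T *m Z)).

Lemma support_scale_gt0 : 0 < support_scale.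
Proof. by rewrite sqrtr_gt0. Qed.

Let ZTY T : Z *m T *m Z^T *m Y = Z *m T.
Proof.
by rewrite -(mulmxA _ Z^T) ZY mulmx1.
Qed.

Lemma mximage_congr T : T \in unitmx ->
  mximage (Z *m T *m Z^T) = range (fun s => Z *m s).
Proof.
move=> uT; apply/seteqP; split=> [_ [v _ <-]|_ [s _ <-]].
  by exists (T *m (Z^T *m v)) => //; rewrite !mulmxA.
by exists (Y *m (invmx T *m s)) => //; rewrite mulmxA ZTY -mulmxA mulKVmx.
Qed.

Lemma rank_congr T : T \in unitmx -> \rank (Z *m T *m Z^T) = k.
Proof.
move=> uT; apply/eqP; rewrite eqn_leq; apply/andP; split.
  exact/(leq_trans (mxrankM_maxr _ _))/rank_leq_row.
have := mxrankM_maxr (Y^T) (Z *m T *m Z^T *m Y).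
rewrite ZTY !mulmxA YZ mul1mx mxrank_unit// => /leq_trans; apply.
by rewrite -{1}ZTY mxrankM_maxl.
Qed.

Lemma gauss_supp_congr m mu T : T \in unitmx ->
  gauss_supp (m + Z *m mu) (Z *m T *m Z^T) = range (fun s => m + Z *m s).
Proof.
move=> uT; rewrite /gauss_supp mximage_congr//; apply/seteqP; split.
  move=> _ [_ [s _ <-] <-]; exists (mu + s) => //.
  by rewrite mulmxDr addrA.
move=> _ [s _ <-]; exists (Z *m (s - mu)); first by exists (s - mu).
by rewrite mulmxBr addrA addrAC addrK.
Qed.

Lemma gauss_supp_congr0 m T : T \in unitmx ->
  gauss_supp m (Z *m T *m Z^T) = range (fun s => m + Z *m s).
Proof. by move=> uT; have := gauss_supp_congr m 0 uT; rewrite mulmx0 addr0. Qed.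

(** The affine subspace is the zero set of [z |-> (1 - Z Y^T) (z - m)], a finite intersection of
    preimages under measurable coordinates. *)
Lemma measurable_affine_range m : measurable (range (fun s => m + Z *m s)).
Proof.
pose A := 1%:M - Z *m Y^T.
pose h (z : 'cV[R]_N) := A *m z + (- (A *m m)).
have mh : measurable_fun setT h by exact: measurable_cV_affine.
suff -> : range (fun s => m + Z *m s) =
    \bigcap_(i in [set: 'I_N]) ((@cV_coord R N i \o h) @^-1` [set 0]).
  apply: fin_bigcap_measurable => // i _.
  rewrite -[X in measurable X]setTI.
  exact: (measurableT_comp (@measurable_cV_coord R N i) mh).
have hE z : h z = (z - m) - Z *m (Y^T *m (z - m)).
  by rewrite /h -mulmxBr /A mulmxBl mul1mx mulmxA.
apply/seteqP; split=> [_ [s _ <-] i _|z h0] /=.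
  rewrite /comp /= hE [m + _]addrC addrK [Y^T *m _]mulmxA YZ mul1mx subrr.
  by rewrite /cV_coord mxE.
exists (Y^T *m (z - m)) => //.
have : h z = 0 by apply/colP => i; rewrite [RHS]mxE; exact: h0.
by rewrite hE => /eqP; rewrite subr_eq0 => /eqP <-; rewrite addrC subrK.
Qed.

(** The chosen orthonormal basis spans the same space as [Z], so it is [Z B] for a square [B].
    Orthonormality reads [B^T (Z^T Z) B = 1], hence [support_scale * |\det B| = 1], and what remains
    is a linear change of variables. Only these properties of the arbitrary choice [orthobasis] are
    used. *)
Lemma ge0_integral_aff m T (F : 'cV[R]_N -> \bar R) (G : 'cV[R]_k -> \bar R) :
  T^T = T -> T \in unitmx -> (forall s, F (m + Z *m s) = G s) ->
  measurable_fun setT G -> (forall s, 0 <= G s)%E ->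
  (\int[aff_lebesgue m (Z *m T *m Z^T)]_(z in gauss_supp m (Z *m T *m Z^T)) F z =
   support_scale%:E * \int[lebesgue_cV R k]_s G s)%E.
Proof.
move=> symT uT FG mG G0; set K := Z *m T *m Z^T.
have symK : K^T = K by rewrite /K !trmx_mul trmxK symT mulmxA.
have rk : \rank K = k by exact: rank_congr.
pose sg (z : 'cV[R]_N) := Y^T *m z + (- (Y^T *m m)).
have msg : measurable_fun setT sg by exact: measurable_cV_affine.
have sgE s : sg (m + Z *m s) = s.
  by rewrite /sg -mulmxBr addrC addKr mulmxA YZ mul1mx.
have DE : gauss_supp m K = range (fun s => m + Z *m s) by exact: gauss_supp_congr0.
have mD : measurable (gauss_supp m K) by rewrite DE; exact: measurable_affine_range.
have KE : mximage K = range (fun s => Z *m s) := mximage_congr uT.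
have [WW rW] := orthobasisP symK; move: WW rW; rewrite /aff_lebesgue.
move: (orthobasis K) => W WW rW.
have mphi : measurable_fun setT (fun u : 'cV[R]_(\rank K) => m + W *m u).
  by apply: measurable_cV_add => //; exact: measurable_cV_mulmx.
pose nu : {measure set 'cV[R]_N -> \bar R} :=
  measure_function_pushforward__canonical__measure_function_Measure
    (lebesgue_cV R (\rank K)) mphi.
(* [F] is known only on the support, so it is replaced by [G] composed with the left inverse [sg],
   which is measurable everywhere. *)
transitivity (\int[nu]_(z in gauss_supp m K) G (sg z))%E.
  apply: (@eq_integral _ _ _ nu) => z /set_mem; rewrite DE => -[s _ <-].
  by rewrite FG sgE.
rewrite (ge0_integral_pushforward mphi)//; last first.
  by apply: measurable_funTS; exact: measurableT_comp.
have preT : (fun u : 'cV[R]_(\rank K) => m + W *m u) @^-1` gauss_supp m K = setT.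
  apply/seteqP; split=> // u _ /=; exists (W *m u) => //.
  by rewrite -rW; exists u.
rewrite preT; pose B := Y^T *m W.
have WE : W = Z *m B.
  have col j : W *m delta_mx j ord0 = Z *m (B *m delta_mx j ord0 : 'cV_k).
    have : range (fun u : 'cV[R]_(\rank K) => W *m u) (W *m delta_mx j ord0).
      by exists (delta_mx j ord0).
    rewrite rW KE => -[s _ e].
    by rewrite /B -mulmxA -e (mulmxA Y^T) YZ mul1mx.
  apply/matrixP => i j; have /matrixP/(_ i ord0) := col j.
  by rewrite mulmxA -!colE !mxE.
under eq_integral => u _.
  rewrite /= (_ : sg (m + W *m u) = B *m u); last by rewrite WE -mulmxA sgE.
  over.
rewrite WE in WW.
(* The rank of [K] equals [k] only propositionally; generalizing over [j] allows the substitution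
   that makes the matrix square. *)
suff key j (C : 'M[R]_(k, j)) : j = k -> (Z *m C)^T *m (Z *m C) = 1%:M ->
    (\int[lebesgue_cV R j]_u G (C *m u) =
     support_scale%:E * \int[lebesgue_cV R k]_s G s)%E by exact: key.
move=> jk; subst j; clear -uZ detZ_gt0 mG G0.
move=> WW; have {}WW : (C^T *m (Z^T *m Z)) *m C = 1%:M.
  by rewrite -WW trmx_mul !mulmxA.
have uC : C \in unitmx by have [] := mulmx1_unit WW.
have detC : support_scale * `|\det C| = 1.
  rewrite -sqrtr_sqr -sqrtrM ?(ltW detZ_gt0)//.
  have /(congr1 determinant) := WW; rewrite !det_mulmx det_tr det1 => e.
  by rewrite (_ : _ * _ = 1) ?sqrtr1// -e; ring.
rewrite -(@integral_cV_affine _ _ C 0 _ uC mG G0) muleA -EFinM detC mul1e.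
by apply: eq_integral => u _; rewrite addr0.
Qed.

Lemma integral_aff m T (F : 'cV[R]_N -> \bar R) (G : 'cV[R]_k -> \bar R) :
  T^T = T -> T \in unitmx -> (forall s, F (m + Z *m s) = G s) ->
  (lebesgue_cV R k).-integrable setT G ->
  (\int[aff_lebesgue m (Z *m T *m Z^T)]_(z in gauss_supp m (Z *m T *m Z^T)) F z =
   support_scale%:E * \int[lebesgue_cV R k]_s G s)%E.
Proof.
move=> symT uT FG iG; have mG := measurable_int _ iG.
have mphi : measurable_fun setT (fun u : 'cV[R]_(\rank (Z *m T *m Z^T)) =>
    m + orthobasis (Z *m T *m Z^T) *m u).
  by apply: measurable_cV_add => //; exact: measurable_cV_mulmx.
rewrite [LHS](@integralE _ _ _
  (measure_function_pushforward__canonical__measure_function_Measure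
    (lebesgue_cV R _) mphi)).
rewrite (@ge0_integral_aff m T (F^\+)%E (G^\+)%E)//; last 2 first.
- by move=> s; rewrite !funeposE FG.
- exact: measurable_funepos.
rewrite (@ge0_integral_aff m T (F^\-)%E (G^\-)%E)//; last 2 first.
- by move=> s; rewrite !funenegE FG.
- exact: measurable_funeneg.
rewrite [X in (_ = _ * X)%E](@integralE _ _ _ (lebesgue_cV R k)).
rewrite [RHS]muleBr//.
apply: fin_num_adde_defr.
exact: integrable_pos_fin_num.
Qed.

(** The factor [\det (Z^T Z)] of the pseudo-determinant cancels the Jacobian, and the dual frame in
    the pseudo-inverse cancels [Z] in the exponent. *)
Lemma gauss_pdf_congr m mu T s : posdef T ->
  support_scale * gauss_pdf (m + Z *m mu) (Z *m T *m Z^T) (m + Z *m s) =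
  gauss_density mu T s.
Proof.
move=> pT; have uT := posdef_unitmx pT.
rewrite /gauss_pdf indicE mem_set; last first.
  by rewrite gauss_supp_congr//; exists s.
rewrite [true%:R * _]mul1r rank_congr// pdet_congr//; last exact: pT.1.
rewrite mulrA; congr (_ * expR (_ * _)).
  rewrite /support_scale mulrCA sqrtrM ?(ltW detZ_gt0)// invfM mulrA.
  by rewrite divff ?mul1r// gt_eqF// sqrtr_gt0.
rewrite [m + Z *m s]addrC addrKA -mulmxBr mp_inv_congr// -/Y.
move: (Y) YZ ZY => V VZ ZV.
by rewrite trmx_mul -!mulmxA (mulmxA V^T) VZ mul1mx (mulmxA Z^T) ZV mul1mx !mulmxA.
Qed.

(** Equal supports force the mean into the affine subspace and the image of [Kt] to be the range of
    [Z]. The projector [Z V^T] then fixes [Kt] on both sides, so [Kt = Z S Z^T] with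
    [S = V^T Kt V]. *)
Lemma gauss_supp_coords m T mt (Kt : 'M[R]_N) : T \in unitmx -> psd Kt ->
  gauss_supp mt Kt = gauss_supp m (Z *m T *m Z^T) ->
  exists mu S, [/\ posdef S, mt = m + Z *m mu & Kt = Z *m S *m Z^T].
Proof.
move=> uT pK; move: (Y) YZ ZY => V VZ ZV; rewrite gauss_supp_congr0// => suppE.
have [mu _ mtE] : range (fun s => m + Z *m s) mt.
  by rewrite -suppE; exists 0; [exists 0; rewrite ?mulmx0|rewrite addr0].
have imK v : exists s, Kt *m v = Z *m s.
  have : gauss_supp mt Kt (mt + Kt *m v) by exists (Kt *m v) => //; exists v.
  rewrite suppE -mtE => -[s _ e]; exists (s - mu).
  by rewrite mulmxBr; apply: (addrI (m + Z *m mu)); rewrite -e addrACA subrr addr0.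
have imZ s : exists v, Z *m s = Kt *m v.
  have : range (fun s => m + Z *m s) (m + Z *m (mu + s)) by exists (mu + s).
  rewrite -suppE -mtE => -[_ [v _ <-] e]; exists v.
  by apply: (addrI (m + Z *m mu)); rewrite e mulmxDr addrA.
have KtE : Z *m V^T *m Kt = Kt.
  apply/matrixP => i j; have [s e] := imK (delta_mx j ord0).
  have : (Z *m V^T *m Kt) *m delta_mx j ord0 = Kt *m delta_mx j ord0 :> 'cV[R]_N.
    by rewrite -(mulmxA _ Kt) e -mulmxA (mulmxA V^T) VZ mul1mx.
  by move=> /matrixP/(_ i ord0); rewrite -!colE !mxE.
have KtS : Kt = Z *m (V^T *m Kt *m V) *m Z^T.
  rewrite !mulmxA KtE; apply: trmx_inj.
  by rewrite !trmx_mul trmxK pK.1 mulmxA KtE.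
set S := V^T *m Kt *m V in KtS; exists mu, S; split=> //.
have pS : psd S by exact: psd_congr.
(* For [Z s = Kt v] one gets [s = S Z^T v], so [S s = 0] gives [|s|^2 = v^T Z S s = 0]. *)
apply: psd_unit_posdef => //; apply: unitmx_inj => s Ss.
have [v e] := imZ s.
have sE : s = S *m (Z^T *m v).
  by rewrite -[s]mul1mx -VZ -mulmxA e {1}KtS !mulmxA VZ mul1mx.
apply/eqP; rewrite -sqnorm_eq0 -sqnormE {1}sE trmx_mul pS.1 -mulmxA Ss.
by rewrite mulmx0 mxE.
Qed.

End SupportCoordinates.

(** * Maximization of a quadratic risk over a divergence ball *)

Section GaussianDivergence.
Variable R : realType.

(* Divergence of [N (mu, T)] from [N (0, T0)]. *)
Definition gauss_kl k (mu : 'cV[R]_k) (T T0 : 'M[R]_k) : R :=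
  1 / 2 * (ln (\det T0) - ln (\det T) + \tr (invmx T0 *m T)
           + (mu^T *m invmx T0 *m mu) ord0 ord0 - k%:R).

Lemma ln_gauss_density k (mu s : 'cV[R]_k) (T : 'M[R]_k) : posdef T ->
  ln (gauss_density mu T s) =
  - (1 / 2) * (ln ((2 * pi) ^+ k) + ln (\det T)
               + ((s - mu)^T *m invmx T *m (s - mu)) ord0 ord0).
Proof.
move=> pT; have dT := posdef_det_gt0 pT.
have c0 : 0 < (2 * pi : R) ^+ k by rewrite exprn_gt0// mulr_gt0// pi_gt0.
have ln_sqrt (x : R) : 0 < x -> ln (Num.sqrt x) = 1 / 2 * ln x.
  move=> x0; rewrite -{2}(sqr_sqrtr (ltW x0)) lnXn ?sqrtr_gt0// -mulr_natr.
  by field.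
rewrite /gauss_density lnM ?posrE ?expR_gt0// ?invr_gt0 ?sqrtr_gt0 ?mulr_gt0//.
rewrite expRK lnV ?posrE ?sqrtr_gt0 ?mulr_gt0// ln_sqrt ?mulr_gt0// lnM ?posrE//.
ring.
Qed.

Lemma gauss_kl0 k (T T0 : 'M[R]_k) : gauss_kl 0 T T0 =
  1 / 2 * (ln (\det T0) - ln (\det T) + \tr (invmx T0 *m T) - k%:R).
Proof. by rewrite /gauss_kl mulmx0 [X in _ + X - _]mxE addr0. Qed.

Lemma gauss_kl_le0_eq k (mu : 'cV[R]_k) (T T0 : 'M[R]_k) : posdef T -> posdef T0 ->
  gauss_kl mu T T0 <= 0 -> T = T0 /\ mu = 0.
Proof.
move=> pT pT0; have [le eq] := ln_det_gibbs pT pT0.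
have piT := posdef_invmx pT0.
have q0 := (posdef_psd piT).2 mu.
rewrite /gauss_kl; set t := \tr _ in le eq *; set q := (_ ord0 ord0) in q0 * => h.
have e : ln (\det T) - t + k%:R = ln (\det T0) by lra.
have {}q0 : q = 0 by lra.
split; first by apply/eqP; rewrite -eq e eqxx.
apply/eqP; apply: contraT => /piT.2; rewrite -/q q0 ltxx //.
Qed.

Lemma gauss_kl_maximizer k (mu : 'cV[R]_k) (T T0 T1 X : 'M[R]_k) (theta : R) :
  posdef T -> posdef T0 -> posdef T1 -> 0 < theta ->
  theta *: X = invmx T0 - invmx T1 ->
  gauss_kl mu T T0 <= gauss_kl 0 T1 T0 ->
  \tr (X *m T) + (mu^T *m X *m mu) ord0 ord0 <= \tr (X *m T1)
    ?= iff (T == T1) && (mu == 0).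
Proof.
move=> pT pT0 pT1 t0 XE.
have piT := posdef_invmx pT1.
have q0 := (posdef_psd piT).2 mu.
have [le eq] := ln_det_gibbs pT pT1.
have trX S : theta * \tr (X *m S) = \tr (invmx T0 *m S) - \tr (invmx T1 *m S).
  by rewrite -mxtraceZ scalemxAl XE mulmxBl raddfB.
have qX : theta * (mu^T *m X *m mu) ord0 ord0 =
    (mu^T *m invmx T0 *m mu) ord0 ord0 - (mu^T *m invmx T1 *m mu) ord0 ord0.
  rewrite (_ : theta * _ = (mu^T *m (theta *: X) *m mu) ord0 ord0); last first.
    by rewrite -scalemxAr -scalemxAl [RHS]mxE.
  by rewrite XE mulmxBr mulmxBl !mxE.
rewrite [X in _ <= X]gauss_kl0 /gauss_kl.
have := trX T1; rewrite mulVmx ?posdef_unitmx// mxtrace1 => trX1.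
have {trX} := trX T => trXT h.
set q1 := (mu^T *m invmx T1 *m mu) ord0 ord0 in q0 qX *.
set q2 := (mu^T *m invmx T0 *m mu) ord0 ord0 in qX h.
set a := \tr (X *m T) in trXT *; set b := (_ ord0 ord0) in qX *.
set b1 := \tr (X *m T1) in trX1 *.
set t01 := \tr (invmx T0 *m T1) in trX1 h; set t0T := \tr (invmx T0 *m T) in trXT h.
set t1T := \tr (invmx T1 *m T) in trXT le eq.
(* The two slacks, that of Gibbs' inequality and the mean term [q1], are kept in the bound. Both are
   nonnegative, which gives the inequality, and both vanish in case of equality, which gives
   uniqueness. *)
have key : theta * (a + b) + (ln (\det T1) - (ln (\det T) - t1T + k%:R)) + q1 <= theta * b1.
  by rewrite mulrDr trXT qX trX1; lra.
split.
  by rewrite -(ler_pM2l t0); lra.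
apply/eqP/andP => [e|[/eqP TE /eqP mu0]]; last first.
  by rewrite /a /b /b1 TE mu0 mulmx0 mxE addr0.
rewrite e in key.
have e1 : ln (\det T) - t1T + k%:R = ln (\det T1) by lra.
have q10 : q1 = 0 by lra.
split; first by rewrite -eq e1 eqxx.
by apply: contraT => /piT.2; rewrite -/q1 q10 ltxx.
Qed.

End GaussianDivergence.

(** * The Kullback-Leibler integral equals the closed formula *)

Section KullbackLeibler.
Variables (R : realType) (N k : nat) (Z : 'M[R]_(N, k)).
Hypothesis uZ : Z^T *m Z \in unitmx.

Lemma KL_congr (m : 'cV[R]_N) (mu : 'cV[R]_k) (T T0 : 'M[R]_k) :
  posdef T -> posdef T0 ->
  KL m (Z *m T0 *m Z^T) (gauss_pdf (m + Z *m mu) (Z *m T *m Z^T))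
    (gauss_pdf m (Z *m T0 *m Z^T)) = (gauss_kl mu T T0)%:E.
Proof.
move=> pT pT0; have piT := posdef_psd (posdef_invmx pT).
have piT0 := posdef_psd (posdef_invmx pT0).
have sc := support_scale_gt0 uZ; have sc0 := lt0r_neq0 sc.
set c := support_scale Z in sc sc0.
have ftE s : gauss_pdf (m + Z *m mu) (Z *m T *m Z^T) (m + Z *m s) =
    c^-1 * gauss_density mu T s.
  by rewrite -(gauss_pdf_congr uZ m mu s pT) mulKf.
have fE s : gauss_pdf m (Z *m T0 *m Z^T) (m + Z *m s) =
    c^-1 * gauss_density 0 T0 s.
  by rewrite -(gauss_pdf_congr uZ m 0 s pT0) mulmx0 addr0 mulKf.
pose a := 1 / 2 * (ln (\det T0) - ln (\det T)).
pose q0 (s : 'cV[R]_k) := ((s - 0)^T *m invmx T0 *m (s - 0)) ord0 ord0.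
pose q1 (s : 'cV[R]_k) := ((s - mu)^T *m invmx T *m (s - mu)) ord0 ord0.
pose g s := gauss_density mu T s.
have ig := integrable_gauss_density mu pT.
have i0 : (lebesgue_cV R k).-integrable setT (fun s => (q0 s * g s)%:E).
  exact: integrable_gauss_quad.
have i1 : (lebesgue_cV R k).-integrable setT (fun s => (q1 s * g s)%:E).
  exact: integrable_gauss_quad.
(* The log-ratio is quadratic, so the integrand splits into the density and two second moments, each
   integrable. The factor [c^-1] disappears inside the ratio and is cancelled outside by the
   Jacobian. *)
pose G (s : 'cV[R]_k) := ((c^-1 * a)%:E * (g s)%:E +
  ((c^-1 / 2)%:E * (q0 s * g s)%:E + (- (c^-1 / 2))%:E * (q1 s * g s)%:E))%E.
have iG : (lebesgue_cV R k).-integrable setT G.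
  by apply: integrableD => //; [exact: integrableZl|
    apply: integrableD => //; exact: integrableZl].
rewrite /KL (@integral_aff _ _ _ _ uZ m T0 _ G)//; last first.
- move=> s; rewrite ftE fE /G -!EFinM -!EFinD; congr (_%:E).
  rewrite -mulf_div divff ?invr_eq0// mul1r.
  rewrite ln_div ?posrE ?gauss_density_gt0// !ln_gauss_density// -/(q0 s) -/(q1 s).
  rewrite /a -/(g s); field.
  by rewrite sc0.
- exact: posdef_unitmx.
- exact: pT0.1.
rewrite /G integralD//; last 2 first.
- exact: integrableZl.
- by apply: integrableD => //; exact: integrableZl.
rewrite integralD//; [|exact: integrableZl|exact: integrableZl].
rewrite !integralZl// integral_gauss_density// !integral_gauss_quad//.
rewrite mulVmx ?posdef_unitmx// mxtrace1 subrr mulmx0 subr0.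
rewrite [(0 : 'M[R]_1) ord0 ord0]mxE mule1 -!EFinM /gauss_kl /a -/c.
congr (_%:E); field.
by rewrite sc0.
Qed.

End KullbackLeibler.

(** * The multiplier equation *)

Section Tilt.
Variable R : realType.

Lemma posdef_block_diag r p (A : 'M[R]_r) (B : 'M[R]_p) :
  posdef A -> posdef B -> posdef (block_mx A 0 0 B).
Proof.
move=> pA pB; split=> [|v v0]; first by rewrite tr_block_mx pA.1 pB.1 !trmx0.
rewrite -[v]vsubmxK tr_col_mx mul_row_block !mulmx0 addr0 add0r mul_row_col mxE.
have [u0|u0] := eqVneq (usubmx v) 0.
  have d0 : dsubmx v != 0.
    by apply: contraNneq v0 => d0; rewrite -[v]vsubmxK u0 d0 col_mx0.
  by rewrite u0 mulmx0 mxE add0r; exact: pB.2.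
rewrite ltr_pwDl//; first exact: pA.2.
exact: (posdef_psd pB).2.
Qed.

Lemma posdef_spectral k (Q : 'M[R]_k) : posdef Q ->
  exists (V : 'M[R]_k) (d : 'rV[R]_k),
    [/\ V^T *m V = 1%:M, Q = V *m diag_mx d *m V^T & forall i, 0 < d ord0 i].
Proof.
move=> pQ; have [V [d [VV QE]]] := spectral_decomposition pQ.1.
exists V, d; split=> //; apply: posdef_diag.
have <- : V^T *m Q *m V = diag_mx d by rewrite QE !mulmxA VV mul1mx -mulmxA VV mulmx1.
apply: posdef_congr => // v Vv; by rewrite -[v]mul1mx -VV -mulmxA Vv mulmx0.
Qed.

Lemma spectral_mul k (V : 'M[R]_k) (d e : 'rV[R]_k) : V^T *m V = 1%:M ->
  (V *m diag_mx d *m V^T) *m (V *m diag_mx e *m V^T) =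
  V *m diag_mx (\row_i (d ord0 i * e ord0 i)) *m V^T.
Proof.
move=> VV; rewrite !mulmxA -(mulmxA _ V^T) VV mulmx1 -(mulmxA V (diag_mx d)).
rewrite mulmx_diag; congr (_ *m diag_mx _ *m _).
Qed.

Lemma spectral_det k (V : 'M[R]_k) (d : 'rV[R]_k) : V^T *m V = 1%:M ->
  \det (V *m diag_mx d *m V^T) = \prod_i d ord0 i.
Proof.
move=> VV; rewrite !det_mulmx mulrAC -det_mulmx (mulmx1C VV) det1 mul1r.
exact: det_diag.
Qed.

Lemma spectral_tr k (V : 'M[R]_k) (d : 'rV[R]_k) : V^T *m V = 1%:M ->
  \tr (V *m diag_mx d *m V^T) = \sum_i d ord0 i.
Proof. by move=> VV; rewrite mxtrace_mulC mulmxA VV mul1mx mxtrace_diag. Qed.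

Lemma spectral_scalar k (V : 'M[R]_k) (a : R) : V^T *m V = 1%:M ->
  V *m diag_mx (const_mx a) *m V^T = a%:M.
Proof.
by move=> VV; rewrite diag_const_mx mul_mx_scalar -scalemxAl (mulmx1C VV) scalemx1.
Qed.

Lemma spectral_invmx k (V : 'M[R]_k) (d : 'rV[R]_k) : V^T *m V = 1%:M ->
  (forall i, d ord0 i != 0) ->
  invmx (V *m diag_mx d *m V^T) = V *m diag_mx (\row_i (d ord0 i)^-1) *m V^T.
Proof.
move=> VV d0.
have E : (V *m diag_mx d *m V^T) *m (V *m diag_mx (\row_i (d ord0 i)^-1) *m V^T) = 1%:M.
  rewrite spectral_mul// -(spectral_scalar 1 VV); congr (_ *m diag_mx _ *m _).
  by apply/rowP => i; rewrite !mxE divff.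
have [u _] := mulmx1_unit E.
by apply: (can_inj (mulKmx u)); rewrite mulmxV.
Qed.

Lemma spectral_posdef k (V : 'M[R]_k) (d : 'rV[R]_k) : V^T *m V = 1%:M ->
  (forall i, 0 < d ord0 i) -> posdef (V *m diag_mx d *m V^T).
Proof.
move=> VV d0; rewrite -{1}[V]trmxK; apply: posdef_congr; last first.
  by move=> v Vv; rewrite -[v]mul1mx -(mulmx1C VV) -mulmxA Vv mulmx0.
split=> [|v]; first by rewrite tr_diag_mx.
rewrite -sqnorm_gt0 => v0; rewrite mxE.
have E i : (v^T *m diag_mx d) ord0 i * v i ord0 = d ord0 i * v i ord0 ^+ 2.
  by rewrite mul_mx_diag !mxE; ring.
under eq_bigr do rewrite E.
rewrite lt0r sumr_ge0 ?andbT; last by move=> i _; rewrite mulr_ge0 ?sqr_ge0// ltW.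
apply: contraTneq v0 => /eqP; rewrite psumr_eq0; last first.
  by move=> i _; rewrite mulr_ge0 ?sqr_ge0// ltW.
move=> /allP h; rewrite -leNgt /sqnorm big1// => i _.
have := h i (mem_index_enum i); rewrite /= mulf_eq0 gt_eqF//= => /eqP.
by [].
Qed.

Lemma spectral_eigenvalue k (V : 'M[R]_k) (d : 'rV[R]_k) a : V^T *m V = 1%:M ->
  eigenvalue (V *m diag_mx d *m V^T) a <-> exists i, a = d ord0 i.
Proof.
move=> VV; rewrite eigenvalue_root_char char_poly_spectral//.
rewrite root_prod_XsubC; split=> [/mapP[i _ ->]|[i ->]]; first by exists i.
by apply/mapP; exists i => //; rewrite mem_index_enum.
Qed.

(** In positive dimension the set of eigenvalues is finite and nonempty, so the supremum defining
    [sigma_max] is attained. *)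
Lemma sigma_max_spectral k (V : 'M[R]_k.+1) (d : 'rV[R]_k.+1) : V^T *m V = 1%:M ->
  (forall i, d ord0 i <= sigma_max (V *m diag_mx d *m V^T)) /\
  exists i, sigma_max (V *m diag_mx d *m V^T) = d ord0 i.
Proof.
move=> VV; rewrite /sigma_max.
have -> : [set a | eigenvalue (V *m diag_mx d *m V^T) a] = range (fun i => d ord0 i).
  apply/seteqP; split=> [a /(spectral_eigenvalue d a VV)[i ->]|_ [i _ <-]].
    by exists i.
  by apply/(spectral_eigenvalue d _ VV); exists i.
pose i0 : 'I_k.+1 := [arg max_(i > ord0) d ord0 i]%O.
have i0P i : d ord0 i <= d ord0 i0.
  by rewrite /i0; case: arg_maxP => //= j _; apply.
have supE : sup (range (fun i => d ord0 i)) = d ord0 i0.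
  apply/eqP; rewrite eq_le; apply/andP; split.
    apply: ge_sup; first by exists (d ord0 ord0), ord0.
    by move=> _ [i _ <-].
  by apply: ub_le_sup; [exists (d ord0 i0) => _ [i _ <-]|exists i0].
by rewrite supE; split => //; exists i0.
Qed.

End Tilt.

(** * The scalar cost of a tilt and the solvability of the budget equation *)

Section TiltFunction.
Variable R : realType.
Implicit Types s t : R.

(* Contribution of an eigenvalue [d] of [Q] to twice the divergence of
   [tilt Q theta], at [t = theta * d]. *)
Definition tilt_cost (t : R) : R := ln (1 - t) + (1 - t)^-1 - 1.

Lemma tilt_cost0 : tilt_cost 0 = 0.
Proof. by rewrite /tilt_cost subr0 ln1 invr1; ring. Qed.

(** In terms of [x = 1 / (1 - s)] the cost is [x - 1 - ln x]. It increases because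
    [ln (y / x) < y / x - 1 <= y - x] when [1 <= x < y]. *)
Lemma tilt_cost_lt s t : 0 <= s -> s < t -> t < 1 -> tilt_cost s < tilt_cost t.
Proof.
move=> s0 st t1; rewrite /tilt_cost.
pose x := (1 - s)^-1; pose y := (1 - t)^-1.
have x0 : 0 < x by rewrite invr_gt0; lra.
have x1 : 1 <= x by rewrite invf_ge1; lra.
have xy : x < y by rewrite ltf_pV2 ?posrE; lra.
have -> : ln (1 - s) = - ln x by rewrite lnV ?opprK// posrE; lra.
have -> : ln (1 - t) = - ln y by rewrite lnV ?opprK// posrE; lra.
rewrite -/x -/y.
have y0 : 0 < y by lra.
have : ln (y / x) < y / x - 1.
  apply: ln_lt_subr1; first by rewrite divr_gt0.
  apply: contraTneq xy => e.
  by rewrite -leNgt -[y](divfK (lt0r_neq0 x0)) e mul1r.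
rewrite ln_div ?posrE// => h.
have : y / x - 1 <= y - x.
  rewrite -[X in _ - X](divff (lt0r_neq0 x0)) -mulrBl ler_pdivrMr// ler_peMr//; lra.
lra.
Qed.

Lemma tilt_cost_ge0 t : 0 <= t -> t < 1 -> 0 <= tilt_cost t.
Proof.
rewrite le_eqVlt => /predU1P[<- _|t0 t1]; first by rewrite tilt_cost0.
by rewrite -tilt_cost0 ltW// tilt_cost_lt.
Qed.

(** Makes the blow-up at 1 quantitative. It comes from [ln x = ln (x / 2) + ln 2 <= x / 2] at
    [x = 1 / (1 - t)]. *)
Lemma tilt_cost_lower t : t < 1 -> (1 - t)^-1 / 2 - 1 <= tilt_cost t.
Proof.
move=> t1; rewrite /tilt_cost.
pose x := (1 - t)^-1; have x0 : 0 < x by rewrite invr_gt0; lra.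
have -> : ln (1 - t) = - ln x by rewrite lnV ?opprK// posrE; lra.
rewrite -/x.
have h1 : ln (x / 2) <= x / 2 - 1 by apply: ln_le_subr1; rewrite divr_gt0.
have h2 : ln (2 : R) <= 2 - 1 by apply: ln_le_subr1.
rewrite ln_div ?posrE// in h1; lra.
Qed.

Lemma continuous_tilt_cost t : t < 1 -> {for t, continuous tilt_cost}.
Proof.
move=> t1.
have c1 : {for t, continuous (fun t : R => 1 - t)}.
  by apply: cvgB; [exact: cvg_cst|exact: cvg_id].
have t0 : 0 < 1 - t by rewrite subr_gt0.
apply: cvgB; last exact: cvg_cst.
apply: cvgD; last by apply: cvgV => //; exact: lt0r_neq0.
by apply: (continuous_comp c1); exact: continuous_ln.
Qed.

Lemma tilt_cost_root k (d : 'I_k.+1 -> R) (s c : R) : (forall i, 0 < d i) ->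
  (forall i, d i <= s) -> (exists i, s = d i) -> 0 <= c ->
  exists t, [/\ 0 <= t, t * s < 1 & \sum_i tilt_cost (t * d i) = c].
Proof.
move=> d0 ds [i0 sE] c0; have s0 : 0 < s by rewrite sE.
(* Chosen so that [1 - a s = 1 / x]. By the lower bound the largest eigenvalue alone then costs at
   least [x / 2 - 1 = c], so the intermediate value theorem applies on [[0, a]]. *)
pose x := 2 * c + 2; pose a := (1 - x^-1) / s.
have x2 : 2 <= x by rewrite /x; lra.
have x0 : 0 < x by lra.
have ix : x^-1 <= 1 by rewrite invf_le1//; lra.
have ix0 : 0 < x^-1 by rewrite invr_gt0.
have a0 : 0 <= a by rewrite divr_ge0 ?(ltW s0)//; lra.
have as1 : a * s < 1 by rewrite divfK ?gt_eqF//; lra.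
have ad t i : 0 <= t -> t * s < 1 -> 0 <= t * d i < 1.
  move=> t0 ts; rewrite mulr_ge0 ?(ltW (d0 i))//=.
  by apply: le_lt_trans ts; rewrite ler_wpM2l.
have fa : c <= \sum_i tilt_cost (a * d i).
  rewrite (bigD1 i0)//= -sE.
  have h : c <= tilt_cost (a * s).
    have := tilt_cost_lower as1.
    rewrite {1}/a divfK ?gt_eqF// subKr invrK /x; lra.
  rewrite (le_trans h)// lerDl sumr_ge0// => i _.
  by have /andP[] := ad a i a0 as1; exact: tilt_cost_ge0.
have f0 : \sum_i tilt_cost (0 * d i) = 0.
  by rewrite big1// => i _; rewrite mul0r tilt_cost0.
have [||t] := @IVT R (fun t => \sum_i tilt_cost (t * d i)) 0 a c a0.
- apply: continuous_in_subspaceT => t; rewrite inE/= in_itv/= => /andP[t0 ta].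
  have ts : t * s < 1 by apply: le_lt_trans as1; rewrite ler_wpM2r// ltW.
  apply: cvg_big => [|i _]; first exact: add_continuous.
  apply: (@continuous_comp _ _ _ (fun x : R => x * d i)).
    by apply: cvgM; [exact: cvg_id|exact: cvg_cst].
  by apply: continuous_tilt_cost; have /andP[] := ad t i t0 ts.
- by rewrite f0 (min_idPl _) ?(max_idPr _) ?c0 ?fa ?(le_trans c0 fa).
rewrite in_itv/= => /andP[t0 ta] e; exists t; split => //.
by apply: le_lt_trans as1; rewrite ler_wpM2r// ltW.
Qed.

End TiltFunction.

(** * The robust covariance in coordinates and the multiplier *)

Section RobustCovariance.
Variable R : realType.

(** The covariance of [N (0, Q)] reweighted by [exp (theta |v|^2 / 2)], as long as this weight is
    integrable. *)
Definition tilt k (Q : 'M[R]_k) (theta : R) : 'M[R]_k :=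
  invmx (invmx Q - theta%:M).

Lemma tilt0 k (Q : 'M[R]_k) : tilt Q 0 = Q.
Proof. by rewrite /tilt raddf0 subr0 invmxK. Qed.

Lemma gauss_klxx k (T : 'M[R]_k) : T \in unitmx -> gauss_kl 0 T T = 0.
Proof. by move=> uT; rewrite gauss_kl0 mulVmx// mxtrace1 subrr add0r subrr mulr0. Qed.

Lemma mp_inv_coisometry r n (H : 'M[R]_(r, n)) (Q : 'M[R]_r) :
  H *m H^T = 1%:M -> Q \in unitmx ->
  mp_inv (H^T *m Q *m H) = H^T *m invmx Q *m H.
Proof.
move=> HH uQ; have := @mp_inv_congr R n r H^T Q.
by rewrite trmxK HH invmx1 mulmx1 trmxK; apply=> //; rewrite unitmx1.
Qed.

Lemma pdet_coisometry r n (H : 'M[R]_(r, n)) (Q : 'M[R]_r) :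
  H *m H^T = 1%:M -> posdef Q -> pdet (H^T *m Q *m H) = \det Q.
Proof.
move=> HH pQ; have := @pdet_congr R n r H^T Q.
by rewrite trmxK HH det1 mul1r; apply; rewrite ?unitmx1 ?posdef_unitmx// pQ.1.
Qed.

Lemma rank_coisometry r n (H : 'M[R]_(r, n)) (Q : 'M[R]_r) :
  H *m H^T = 1%:M -> Q \in unitmx -> \rank (H^T *m Q *m H) = r.
Proof.
move=> HH uQ; have := @rank_congr R n r H^T _ Q uQ.
by rewrite trmxK; apply; rewrite HH unitmx1.
Qed.

Lemma budget_coisometry r n (H : 'M[R]_(r, n)) (Q Q1 : 'M[R]_r) :
  H *m H^T = 1%:M -> posdef Q -> posdef Q1 ->
  budget (H^T *m Q *m H) (H^T *m Q1 *m H) = gauss_kl 0 Q1 Q.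
Proof.
move=> HH pQ pQ1; have uQ := posdef_unitmx pQ.
rewrite gauss_kl0 /budget !pdet_coisometry// rank_coisometry//.
rewrite mp_inv_coisometry//.
have -> : \tr (H^T *m invmx Q *m H *m (H^T *m Q1 *m H)) = \tr (invmx Q *m Q1).
  rewrite -!mulmxA (mulmxA H) HH mul1mx mxtrace_mulC -!mulmxA HH mulmx1.
  by [].
by [].
Qed.

Lemma robust_cov_coisometry r n (H : 'M[R]_(r, n)) (Q : 'M[R]_r) (lambda : \bar R) :
  H *m H^T = 1%:M -> Q \in unitmx ->
  invmx Q - (fine lambda^-1%E)%:M \in unitmx ->
  robust_cov (H^T *m Q *m H) H lambda = H^T *m tilt Q (fine lambda^-1%E) *m H.
Proof.
move=> HH uQ ut; rewrite /robust_cov mp_inv_coisometry//.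
rewrite -(mp_inv_coisometry HH ut); congr mp_inv.
by rewrite mulmxBr mulmxBl mul_mx_scalar -scalemxAl.
Qed.

(** Identifies the matrix in the lower bound on the multiplier: its eigenvalues are those of [Q]. *)
Lemma sigma_max_coisometry r n (H : 'M[R]_(r, n)) (Q : 'M[R]_r) :
  H *m H^T = 1%:M -> Q \in unitmx ->
  H *m H^T *m invmx (H *m mp_inv (H^T *m Q *m H) *m H^T) *m (H *m H^T) = Q.
Proof.
move=> HH uQ; rewrite mp_inv_coisometry// HH mul1mx mulmx1 !mulmxA HH mul1mx.
by rewrite -mulmxA HH mulmx1 invmxK.
Qed.

Lemma tilt_spectral k (V : 'M[R]_k) (d : 'rV[R]_k) theta : V^T *m V = 1%:M ->
  (forall i, 0 < d ord0 i) -> (forall i, theta * d ord0 i < 1) ->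
  let Q := V *m diag_mx d *m V^T in
  [/\ invmx Q - theta%:M \in unitmx, posdef (tilt Q theta) &
      gauss_kl 0 (tilt Q theta) Q = 1 / 2 * \sum_i tilt_cost (theta * d ord0 i)].
Proof.
move=> VV d0 td Q.
have nz i : d ord0 i != 0 by rewrite gt_eqF.
have E : invmx Q - theta%:M =
    V *m diag_mx (\row_i ((d ord0 i)^-1 - theta)) *m V^T.
  rewrite /Q spectral_invmx// -(spectral_scalar theta VV) -mulmxBl -mulmxBr.
  rewrite -raddfB/=; congr (_ *m diag_mx _ *m _); by apply/rowP => i; rewrite !mxE.
have e0 i : 0 < (d ord0 i)^-1 - theta.
  by rewrite subr_gt0 -[X in _ < X]mul1r ltr_pdivlMr.
have pE : posdef (invmx Q - theta%:M).
  by rewrite E; apply: spectral_posdef => // i; rewrite mxE.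
have tE : tilt Q theta = V *m diag_mx (\row_i (d ord0 i / (1 - theta * d ord0 i))) *m V^T.
  rewrite /tilt E spectral_invmx//; last by move=> i; rewrite mxE gt_eqF.
  congr (_ *m diag_mx _ *m _); apply/rowP => i; rewrite !mxE.
  have := td i; rewrite -subr_gt0 => /lt0r_neq0 h.
  have h2 := lt0r_neq0 (e0 i); field.
  by rewrite h nz.
split; [exact: posdef_unitmx|exact: posdef_invmx|].
rewrite gauss_kl0 tE /Q !spectral_det// spectral_invmx// spectral_mul// spectral_tr//.
rewrite !ln_prod//; last first.
  by move=> i _; rewrite mxE divr_gt0// subr_gt0.
have -> : k%:R = \sum_(i < k) (1 : R) by rewrite sumr_const card_ord.
congr (_ * _); rewrite -sumrB -big_split/= -sumrB.
apply: eq_bigr => i _; rewrite !mxE /tilt_cost.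
have t0 : 0 < 1 - theta * d ord0 i by rewrite subr_gt0.
rewrite ln_div ?posrE// mulrA mulVf// mul1r.
ring.
Qed.

Lemma robust_multiplier r n (H : 'M[R]_(r, n)) (Q : 'M[R]_r) (c : R) :
  (0 < r)%N -> H *m H^T = 1%:M -> posdef Q -> 0 <= c ->
  let P := H^T *m Q *m H in
  exists lambda : \bar R, let theta := fine lambda^-1%E in
    [/\ [/\ 0 <= theta, posdef (tilt Q theta) & invmx Q - theta%:M \in unitmx],
        ((sigma_max Q)%:E < lambda)%E, gauss_kl 0 (tilt Q theta) Q = c,
        forall lambda' : \bar R, ((sigma_max Q)%:E < lambda')%E ->
          budget P (robust_cov P H lambda') = c -> lambda' = lambda &
        (lambda = +oo%E /\ c = 0) \/ (lambda \is a fin_num /\ 0 < theta /\ 0 < c)].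
Proof.
case: r H Q => [//|k] H Q _ HH pQ c0 P; have uQ := posdef_unitmx pQ.
have [V [d [VV QE d0]]] := posdef_spectral pQ.
have [ds [i0 sE]] := sigma_max_spectral d VV; rewrite -QE in ds sE.
set s := sigma_max Q in ds sE *; have s0 : 0 < s by rewrite sE.
have tilted t : 0 <= t -> t * s < 1 ->
    [/\ invmx Q - t%:M \in unitmx, posdef (tilt Q t) &
      gauss_kl 0 (tilt Q t) Q = 1 / 2 * \sum_i tilt_cost (t * d ord0 i)].
  move=> t0 ts; have td i : t * d ord0 i < 1.
    by apply: le_lt_trans ts; rewrite ler_wpM2l.
  by have := tilt_spectral VV d0 td; rewrite -QE.
(* The divergence is half the sum of the costs, so the root is taken at level [2 * c]. *)
have [t [t0 ts tE]] := tilt_cost_root d0 ds (ex_intro _ i0 sE) (mulr_ge0 (ler0n _ 2) c0).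
have [ut pt klt] := tilted t t0 ts.
have {}klt : gauss_kl 0 (tilt Q t) Q = c by rewrite klt tE; field.
have inj t1 t2 : 0 <= t1 -> t1 < t2 -> t2 * s < 1 ->
    gauss_kl 0 (tilt Q t1) Q < gauss_kl 0 (tilt Q t2) Q.
  move=> h1 h12 h2; have h3 : t1 * s < 1 by rewrite (lt_trans _ h2)// ltr_pM2r.
  have [_ _ ->] := tilted t1 h1 h3; have [_ _ ->] := tilted t2 (le_trans h1 (ltW h12)) h2.
  rewrite ltr_pM2l ?divr_gt0//; apply: ltr_sum.
    by apply/hasP; exists ord0; rewrite ?mem_index_enum.
  move=> i _; apply: tilt_cost_lt; rewrite ?mulr_ge0 ?ltr_pM2r ?(ltW (d0 i))//.
  by apply: le_lt_trans h2; rewrite ler_wpM2l// (le_trans h1)// ltW.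
have budE (l : \bar R) : 0 <= fine l^-1%E -> fine l^-1%E * s < 1 ->
    budget P (robust_cov P H l) = gauss_kl 0 (tilt Q (fine l^-1%E)) Q.
  move=> l0 ls; have [u p _] := tilted _ l0 ls.
  by rewrite /P robust_cov_coisometry// budget_coisometry.
have lamP (l : \bar R) : (s%:E < l)%E -> 0 <= fine l^-1%E /\ fine l^-1%E * s < 1.
  case: l => [l| |//]; last by rewrite invey /= mul0r.
  rewrite lte_fin => sl; have l0 : 0 < l by exact: lt_trans sl.
  by rewrite inver gt_eqF//= invr_ge0 (ltW l0) mulrC ltr_pdivrMr// mul1r.
(* A zero tilt corresponds to an infinite multiplier; this happens exactly when [c = 0]. *)
pose lam : \bar R := if t == 0 then +oo%E else (t^-1)%:E.
have lamE : fine lam^-1%E = t.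
  rewrite /lam; case: eqVneq => [->|tn0]; first by rewrite invey.
  by rewrite inver invr_eq0 (negPf tn0) /= invrK.
have slam : (s%:E < lam)%E.
  rewrite /lam; case: eqVneq => [_|tn0]; first by rewrite ltry.
  by rewrite lte_fin -[t^-1]mul1r ltr_pdivlMr ?lt0r ?tn0// mulrC.
exists lam; rewrite lamE; split => //.
- move=> l sl; have [l0 ls] := lamP l sl; rewrite budE// => lE.
  have tl : fine l^-1%E = t.
    apply/eqP; rewrite eq_le; apply/andP; split; rewrite leNgt; apply/negP => h.
      by have := inj _ _ t0 h ls; rewrite lE klt ltxx.
    by have := inj _ _ l0 h ts; rewrite lE klt ltxx.
  (* Since [fine] collapses infinite values, both inverses are shown to be finite before the
     involution is cancelled. *)
  apply: (inv_inj (@inveK R)).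
  have fin (x : \bar R) : (s%:E < x)%E -> x^-1%E \is a fin_num.
    case: x => [x| |//]; last by rewrite invey.
    by rewrite lte_fin => sx; rewrite inver gt_eqF// (lt_trans s0).
  by rewrite -[LHS](fineK (fin _ sl)) -[RHS](fineK (fin _ slam)) tl lamE.
- rewrite /lam; case: eqVneq => [te|tn0].
    by left; split=> //; rewrite -klt te tilt0 gauss_klxx.
  right; split=> //; have t0' : 0 < t by rewrite lt0r tn0.
  split=> //; have := inj 0 t (lexx _) t0' ts.
  by rewrite klt tilt0 gauss_klxx.
Qed.

End RobustCovariance.

(** * The game *)

Section StackedVectors.
Variable R : realType.

Lemma sqnorm_parallelogram k (u v : 'cV[R]_k) :
  sqnorm (u + v) + sqnorm (- u + v) = 2 * sqnorm u + 2 * sqnorm v.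
Proof.
rewrite /sqnorm !mulr_sumr -!big_split/=; apply: eq_bigr => i _.
by rewrite !mxE; ring.
Qed.

(** Lets two possibly infinite risks be compared through their doubles. *)
Lemma eadd_self_inj (x y : \bar R) : (0 <= x)%E -> (0 <= y)%E ->
  (x + x = y + y)%E -> x = y.
Proof.
case: x y => [x| |] [y| |]//= _ _; rewrite -!EFinD => -[] e.
by congr (_%:E); lra.
Qed.

Lemma measurable_usubmx k l : measurable_fun [set: 'cV[R]_(k + l)] usubmx.
Proof.
apply/measurable_fun_cVP => i.
rewrite (_ : _ \o _ = cV_coord (lshift l i)); first exact: measurable_cV_coord.
by apply/funext => v; rewrite /= /cV_coord mxE.
Qed.

Lemma measurable_dsubmx k l : measurable_fun [set: 'cV[R]_(k + l)] dsubmx.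
Proof.
apply/measurable_fun_cVP => i.
rewrite (_ : _ \o _ = cV_coord (rshift k i)); first exact: measurable_cV_coord.
by apply/funext => v; rewrite /= /cV_coord mxE.
Qed.

Lemma dsubmx_cons k l x (v : 'cV[R]_(k + l)) :
  @dsubmx _ k.+1 l 1 (cV_cons (x, v)) = dsubmx v.
Proof.
apply/colP => i; rewrite !mxE.
rewrite (_ : rshift k.+1 i = lift ord0 (rshift k i)) ?liftK//.
exact/val_inj.
Qed.

(** Integrating over a coordinate that does not occur multiplies by the measure of the line, which
    is not zero; so a vanishing integral stays zero when the coordinate is dropped. *)
Lemma integral_dsubmx_eq0 k l (F : 'cV[R]_l -> \bar R) :
  measurable_fun setT F -> (forall y, 0 <= F y)%E ->
  (\int[lebesgue_cV R (k + l)]_s F (dsubmx s) = 0)%E ->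
  (\int[lebesgue_cV R l]_y F y = 0)%E.
Proof.
move=> mF F0; elim: k => [|k IH].
  move=> <-; apply: eq_integral => y _; congr F.
  by apply/colP => i; rewrite mxE; congr (y _ _); exact/val_inj.
have mFd k' : measurable_fun setT (fun s : 'cV[R]_(k' + l) => F (dsubmx s)).
  by apply: (measurableT_comp mF); exact: measurable_dsubmx.
rewrite (integral_cV_cons (mFd k.+1))// => e; apply: IH; move: e.
under eq_integral => x _.
  under eq_integral do rewrite dsubmx_cons.
  over.
rewrite (integral_cst (lebesgue_measure : {measure set (measurableTypeR R) -> \bar R}))//.
move/eqP; rewrite mule_eq0 => /orP[/eqP//|].
move=> /eqP mu0; have : (lebesgue_measure (`[0%R, 1%R]%classic : set R) <= 0)%E.
  by rewrite -mu0; apply: le_measure; rewrite ?inE.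
by rewrite lebesgue_measure_itv/= lte_fin ltr01 -EFinD subr0 lee_fin ler10.
Qed.

Lemma ge0_integral_eq0P k (f : 'cV[R]_k -> R) :
  measurable_fun setT f -> (forall v, 0 <= f v) ->
  (\int[lebesgue_cV R k]_v (f v)%:E = 0)%E <->
  {ae lebesgue_cV R k, forall v, f v = 0}.
Proof.
move=> mf f0; have mf' : measurable_fun setT (EFin \o f) by exact/measurable_EFinP.
have := ae_eq_integral_abs (lebesgue_cV R k) measurableT mf'.
under eq_integral do rewrite gee0_abs ?lee_fin//.
move=> ->; split; apply: filterS => v /=.
  by move=> /(_ I) [].
by move=> -> _.
Qed.

End StackedVectors.

(** * The saddle point in frame coordinates *)

Section GameCoordinates.
Variables (R : realType) (n p r : nat).
Variables (H : 'M[R]_(r, n)) (G : 'M[R]_(n, p)) (Q : 'M[R]_r) (Ky : 'M[R]_p).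
Variable m : 'cV[R]_(n + p).
Hypotheses (HH : H *m H^T = 1%:M) (pQ : posdef Q) (pKy : posdef Ky).

Definition game_frame : 'M[R]_(n + p, r + p) := block_mx H^T G 0 1%:M.
Definition state_proj : 'M[R]_(r + p) := block_mx 1%:M 0 0 0.
Definition frame_cov (Q1 : 'M[R]_r) : 'M[R]_(r + p) := block_mx Q1 0 0 Ky.
Definition affine_estimator (y : 'cV[R]_p) : 'cV[R]_n :=
  usubmx m + G *m (y - dsubmx m).

Local Notation Z := game_frame.
Local Notation T0 := (frame_cov Q).
Local Notation K := (Z *m T0 *m Z^T).
Local Notation X := state_proj.

Lemma game_frameE (s : 'cV[R]_(r + p)) :
  Z *m s = col_mx (H^T *m usubmx s + G *m dsubmx s) (dsubmx s).
Proof. by rewrite -{1}[s]vsubmxK mul_block_col mul0mx add0r mul1mx. Qed.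

Lemma game_frame_unit : Z^T *m Z \in unitmx.
Proof.
apply: posdef_unitmx; apply: posdef_gram => s; rewrite game_frameE => e.
have := congr1 dsubmx e; rewrite col_mxKd linear0 => ds.
have := congr1 usubmx e; rewrite col_mxKu linear0 ds mulmx0 addr0 => us.
by rewrite -[s]vsubmxK ds -[usubmx s]mul1mx -HH -mulmxA us mulmx0 col_mx0.
Qed.
Let uZ := game_frame_unit.

Lemma posdef_frame_cov (Q1 : 'M[R]_r) : posdef Q1 -> posdef (frame_cov Q1).
Proof. by move=> pQ1; exact: posdef_block_diag. Qed.
Let pT0 := posdef_frame_cov pQ.

Lemma state_projE (v : 'cV[R]_(r + p)) :
  (v^T *m X *m v) ord0 ord0 = sqnorm (usubmx v).
Proof.
rewrite -{1 2}[v]vsubmxK tr_col_mx mul_row_block !mulmx0 !addr0 mulmx1 mul_row_col.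
by rewrite mul0mx addr0 sqnormE.
Qed.

Lemma psd_state_proj : psd X.
Proof.
split=> [|v]; first by rewrite tr_block_mx !trmx0 trmx1.
by rewrite state_projE sqnorm_ge0.
Qed.

Lemma ambiguity_coords c ft : ambiguity_set m K c ft <->
  exists mu T, [/\ posdef T, ft = gauss_pdf (m + Z *m mu) (Z *m T *m Z^T) &
                   gauss_kl mu T T0 <= c].
Proof.
split=> [[mt [Kt [pK suppE -> kl]]]|[mu [T [pT -> kl]]]].
  have [mu [T [pT mtE KtE]]] := gauss_supp_coords uZ (posdef_unitmx pT0) pK suppE.
  exists mu, T; split=> //; first by rewrite mtE KtE.
  by move: kl; rewrite mtE KtE KL_congr// lee_fin.
exists (m + Z *m mu), (Z *m T *m Z^T); split=> //.
- by rewrite -{1}[Z]trmxK; exact/psd_congr/posdef_psd.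
- have uT := posdef_unitmx pT; have uT0 := posdef_unitmx pT0.
  by rewrite (gauss_supp_congr uZ m mu uT) (gauss_supp_congr0 uZ m uT0).
- by rewrite KL_congr// lee_fin.
Qed.

Definition estimator_gap (g : 'cV[R]_p -> 'cV[R]_n) (y : 'cV[R]_p) : 'cV[R]_r :=
  H *m (affine_estimator y - g y).

Lemma measurable_affine_estimator : measurable_fun setT affine_estimator.
Proof.
rewrite (_ : affine_estimator = fun y => G *m y + (usubmx m - G *m dsubmx m)).
  exact: measurable_cV_affine.
by apply/funext => y; rewrite /affine_estimator mulmxBr addrCA.
Qed.

Lemma measurable_estimator_gap g : measurable_fun setT g ->
  measurable_fun setT (estimator_gap g).
Proof.
move=> mg; apply: (measurableT_comp (measurable_cV_mulmx H)).
by apply: measurable_cV_add; [exact: measurable_affine_estimator|exact: measurable_cV_opp].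
Qed.

Lemma risk_coords g mu T : measurable_fun setT g -> posdef T ->
  risk m K H (gauss_pdf (m + Z *m mu) (Z *m T *m Z^T)) g =
  (\int[lebesgue_cV R (r + p)]_s
     (sqnorm (usubmx s + estimator_gap g (dsubmx s + dsubmx m))
      * gauss_density mu T s)%:E)%E.
Proof.
move=> mg pT; have sc := support_scale_gt0 uZ; have sc0 := lt0r_neq0 sc.
have mgd := measurable_gauss_density mu T.
have mq : measurable_fun setT (fun s : 'cV[R]_(r + p) =>
    sqnorm (usubmx s + estimator_gap g (dsubmx s + dsubmx m))).
  apply: measurable_sqnorm; apply: measurable_cV_add; first exact: measurable_usubmx.
  apply: (measurableT_comp (measurable_estimator_gap mg)).
  by apply: measurable_cV_add => //; exact: measurable_dsubmx.
pose F (s : 'cV[R]_(r + p)) := ((support_scale Z)^-1%:E *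
  (sqnorm (usubmx s + estimator_gap g (dsubmx s + dsubmx m)) * gauss_density mu T s)%:E)%E.
have F0 s : (0 <= F s)%E.
  by rewrite /F -EFinM lee_fin !mulr_ge0 ?gauss_density_ge0 ?sqnorm_ge0// invr_ge0 ltW.
have mF0 : measurable_fun setT (fun s : 'cV[R]_(r + p) =>
  (sqnorm (usubmx s + estimator_gap g (dsubmx s + dsubmx m)) * gauss_density mu T s)%:E).
  by apply/measurable_EFinP; exact: measurable_funM.
have mF : measurable_fun setT F by exact: measurable_funeM.
rewrite /risk (@ge0_integral_aff _ _ _ _ uZ m T0 _ F)//.
- rewrite /F ge0_integralZl_EFin//; last 2 first.
  + by move=> s _; rewrite lee_fin mulr_ge0 ?gauss_density_ge0 ?sqnorm_ge0.
  + by rewrite invr_ge0 ltW.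
  by rewrite muleA -EFinM divff// mul1e.
- exact: pT0.1.
- exact: posdef_unitmx.
move=> s; rewrite /F -(gauss_pdf_congr uZ m mu s pT) -EFinM; congr (_%:E).
rewrite [RHS]mulrCA mulKf//; congr (sqnorm _ * _).
(* At [z = m + Z s] the vector [H (x - g y)] is the state residual plus the gap at [y], because
   [H H^T = 1]. *)
rewrite game_frameE -[m]vsubmxK add_col_mx !col_mxKu !col_mxKd /estimator_gap /affine_estimator.
rewrite addrK [dsubmx m + _]addrC (addrCA (usubmx m)) -addrA mulmxDr.
by rewrite mulmxA HH mul1mx.
Qed.

Local Notation ghat := affine_estimator.
Local Notation qX v := ((v^T *m X *m v) ord0 ord0).

Lemma risk_affine_estimator mu T : posdef T ->
  risk m K H (gauss_pdf (m + Z *m mu) (Z *m T *m Z^T)) ghat =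
  (\tr (X *m T) + qX mu)%:E.
Proof.
move=> pT; rewrite risk_coords//; last exact: measurable_affine_estimator.
have := integral_gauss_quad mu 0 pT psd_state_proj; rewrite subr0 => <-.
apply: eq_integral => s _; rewrite /estimator_gap subrr mulmx0 addr0 subr0.
by rewrite state_projE.
Qed.

(* Averaging over the reflection of the state residual, which preserves the law,
   removes the cross term with the estimator gap. *)
Lemma risk_gap g Q1 : measurable_fun setT g -> posdef Q1 ->
  risk m K H (gauss_pdf m (Z *m frame_cov Q1 *m Z^T)) g =
  (risk m K H (gauss_pdf m (Z *m frame_cov Q1 *m Z^T)) ghat +
   \int[lebesgue_cV R (r + p)]_s
     (sqnorm (estimator_gap g (dsubmx s + dsubmx m))
      * gauss_density 0 (frame_cov Q1) s)%:E)%E.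
Proof.
move=> mg pQ1; have pT1 := posdef_frame_cov pQ1.
have -> : gauss_pdf m (Z *m frame_cov Q1 *m Z^T) =
    gauss_pdf (m + Z *m 0) (Z *m frame_cov Q1 *m Z^T) by rewrite mulmx0 addr0.
rewrite (risk_coords 0 mg pT1) (risk_coords 0 measurable_affine_estimator pT1).
set T1 := frame_cov Q1 in pT1 *.
have mgd := measurable_gauss_density 0 T1.
have mh : measurable_fun setT (fun s : 'cV[R]_(r + p) => estimator_gap g (dsubmx s + dsubmx m)).
  apply: (measurableT_comp (measurable_estimator_gap mg)).
  by apply: measurable_cV_add => //; exact: measurable_dsubmx.
set h := (fun s : 'cV[R]_(r + p) => estimator_gap g (dsubmx s + dsubmx m)) in mh *.
have mA : measurable_fun setT (fun s : 'cV[R]_(r + p) =>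
    (sqnorm (usubmx s + h s) * gauss_density 0 T1 s)%:E).
  apply/measurable_EFinP/measurable_funM => //; apply: measurable_sqnorm.
  by apply: measurable_cV_add => //; exact: measurable_usubmx.
have mA' : measurable_fun setT (fun s : 'cV[R]_(r + p) =>
    (sqnorm (- usubmx s + h s) * gauss_density 0 T1 s)%:E).
  apply/measurable_EFinP/measurable_funM => //; apply: measurable_sqnorm.
  by apply: measurable_cV_add => //; apply: measurable_cV_opp; exact: measurable_usubmx.
have mU : measurable_fun setT (fun s : 'cV[R]_(r + p) =>
    (sqnorm (usubmx s) * gauss_density 0 T1 s)%:E).
  apply/measurable_EFinP/measurable_funM => //; apply: measurable_sqnorm.
  exact: measurable_usubmx.
have mB : measurable_fun setT (fun s : 'cV[R]_(r + p) =>
    (sqnorm (h s) * gauss_density 0 T1 s)%:E).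
  by apply/measurable_EFinP/measurable_funM => //; exact: measurable_sqnorm.
have nn k (u : 'cV[R]_k) s : (0 <= (sqnorm u * gauss_density 0 T1 s)%:E)%E.
  by rewrite lee_fin mulr_ge0 ?sqnorm_ge0 ?gauss_density_ge0.
pose S : 'M[R]_(r + p) := block_mx (- 1%:M) 0 0 1%:M.
have SE s : S *m s = col_mx (- usubmx s) (dsubmx s).
  by rewrite -{1}[s]vsubmxK mul_block_col !mul0mx addr0 add0r mulNmx !mul1mx.
have SS : S *m S = 1%:M.
  rewrite mulmx_block !mulmx0 !mul0mx !addr0 add0r mulNmx mulmxN opprK !mul1mx.
  by rewrite -scalar_mx_block.
have [uS _] := mulmx1_unit SS.
have qE (a : 'cV[R]_r) (b : 'cV[R]_p) :
    (col_mx a b)^T *m invmx T1 *m col_mx a b =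
    a^T *m invmx Q1 *m a + b^T *m invmx Ky *m b.
  rewrite invmx_block_diag ?posdef_unitmx// tr_col_mx mul_row_block.
  by rewrite !mulmx0 addr0 add0r mul_row_col.
have dS : `|\det S| = 1.
  apply/eqP; rewrite -(eqrXn2 (n := 2))// expr1n -normrX expr2 -det_mulmx SS det1.
  by rewrite normr1.
have sym : (\int[lebesgue_cV R (r + p)]_s (sqnorm (usubmx s + h s) * gauss_density 0 T1 s)%:E =
    \int[lebesgue_cV R (r + p)]_s (sqnorm (- usubmx s + h s) * gauss_density 0 T1 s)%:E)%E.
  rewrite -(@integral_cV_affine _ _ S 0 _ uS mA); last by move=> s; exact: nn.
  rewrite dS mul1e; apply: eq_integral => s _.
  rewrite addr0 SE col_mxKu /h col_mxKd; congr (_ * _)%:E.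
  rewrite /gauss_density !subr0; congr (_ * expR (_ * _)).
  rewrite -[s in RHS]vsubmxK !qE.
  by rewrite mulmxN [(- usubmx s)^T]raddfN !mulNmx opprK.
(* Twice the risk is the sum over [v] and [- v]; the parallelogram law turns it pointwise into twice
   the two terms on the right. *)
apply: eadd_self_inj.
- by apply: integral_ge0 => s _; exact: nn.
- by rewrite adde_ge0//; apply: integral_ge0 => s _; exact: nn.
have gap0 s : usubmx s + estimator_gap ghat (dsubmx s + dsubmx m) = usubmx s.
  by rewrite /estimator_gap subrr mulmx0 addr0.
under [in RHS]eq_integral do rewrite gap0.
rewrite {2}sym -ge0_integralD// -[X in (X + X)%E]ge0_integralD//.
rewrite -ge0_integralD//; last 4 first.
- by move=> s _; rewrite adde_ge0.
- exact: emeasurable_funD.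
- by move=> s _; rewrite adde_ge0.
- exact: emeasurable_funD.
apply: eq_integral => s _; rewrite -!EFinD -!mulrDl sqnorm_parallelogram /h.
by congr (_ * _)%:E; ring.
Qed.

(** The saddle density is positive everywhere, so the gap vanishes almost everywhere for the
    Lebesgue measure. The state coordinates are then dropped and the shift by the mean of [y] is
    undone by translation. *)
Lemma estimator_gap_ae0 g Q1 : measurable_fun setT g -> posdef Q1 ->
  (\int[lebesgue_cV R (r + p)]_s
     (sqnorm (estimator_gap g (dsubmx s + dsubmx m))
      * gauss_density 0 (frame_cov Q1) s)%:E = 0)%E ->
  {ae lebesgue_cV R p, forall y, H *m g y = H *m ghat y}.
Proof.
move=> mg pQ1; have pT1 := posdef_frame_cov pQ1.
have mgap : measurable_fun setT (fun y => sqnorm (estimator_gap g y)).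
  by apply: measurable_sqnorm; exact: measurable_estimator_gap.
have mgap' : measurable_fun setT (fun y : 'cV[R]_p => sqnorm (estimator_gap g (y + dsubmx m))).
  by apply: (measurableT_comp mgap); exact: measurable_cV_add.
have mgapd : measurable_fun setT (fun s : 'cV[R]_(r + p) =>
    sqnorm (estimator_gap g (dsubmx s + dsubmx m))).
  by apply: (measurableT_comp mgap'); exact: measurable_dsubmx.
move=> /ge0_integral_eq0P h.
have : {ae lebesgue_cV R (r + p), forall s,
    sqnorm (estimator_gap g (dsubmx s + dsubmx m)) = 0}.
  have {}h := h (measurable_funM mgapd (measurable_gauss_density 0 (frame_cov Q1)))
    (fun s => mulr_ge0 (sqnorm_ge0 _) (gauss_density_ge0 _ _ _)).
  move: h; apply: filterS => s /eqP; rewrite mulf_eq0 => /orP[/eqP//|].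
  by rewrite gt_eqF// gauss_density_gt0.
move=> /(ge0_integral_eq0P mgapd (fun s => sqnorm_ge0 _)) {h} h.
have mE : measurable_fun setT (fun y => (sqnorm (estimator_gap g y))%:E).
  exact/measurable_EFinP.
have mE' : measurable_fun setT
    (fun y : 'cV[R]_p => (sqnorm (estimator_gap g (y + dsubmx m)))%:E).
  exact/measurable_EFinP.
have := integral_dsubmx_eq0 mE' (fun y => sqnorm_ge0 _) h.
have := integral_cV_affine (dsubmx m) (unitmx1 _ _) mE (fun y => sqnorm_ge0 _).
rewrite det1 normr1 mul1e.
under eq_integral do rewrite mul1mx.
move=> -> /(ge0_integral_eq0P mgap (fun s => sqnorm_ge0 _)).
apply: filterS => y /eqP; rewrite sqnorm_eq0 /estimator_gap mulmxBr subr_eq0.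
by move=> /eqP.
Qed.

(** Saddle point argument: the law of [frame_cov Q1] is worst for the affine estimator, and against
    that law no estimator does better. *)
Theorem affine_estimator_robust c Q1 : posdef Q1 ->
  gauss_kl 0 (frame_cov Q1) T0 <= c ->
  (forall mu T, posdef T -> gauss_kl mu T T0 <= c ->
     \tr (X *m T) + qX mu <= \tr (X *m frame_cov Q1)) ->
  robust_estimator m K H c ghat /\
  forall g, robust_estimator m K H c g ->
    {ae lebesgue_cV R p, forall y, H *m g y = H *m ghat y}.
Proof.
move=> pQ1 kl1 max; have pT1 := posdef_frame_cov pQ1.
set f1 := gauss_pdf m (Z *m frame_cov Q1 *m Z^T).
have f1E : f1 = gauss_pdf (m + Z *m 0) (Z *m frame_cov Q1 *m Z^T).
  by rewrite mulmx0 addr0.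
have af1 : ambiguity_set m K c f1 by apply/ambiguity_coords; exists 0, (frame_cov Q1).
have r1 : risk m K H f1 ghat = (\tr (X *m frame_cov Q1))%:E.
  by rewrite f1E risk_affine_estimator// mulmx0 [X in _ + X]mxE addr0.
have le1 ft : ambiguity_set m K c ft -> (risk m K H ft ghat <= risk m K H f1 ghat)%E.
  move=> /ambiguity_coords[mu [T [pT -> kl]]].
  by rewrite r1 risk_affine_estimator// lee_fin max.
have eg : estimators m K H c ghat.
  split; first exact: measurable_affine_estimator.
  by exists (\tr (X *m frame_cov Q1)) => ft /le1; rewrite r1.
have worst : worst_risk m K H c ghat = risk m K H f1 ghat.
  apply/eqP; rewrite eq_le; apply/andP; split.
    by apply: ge_ereal_sup => _ [ft aft <-]; exact: le1.
  by apply: ereal_sup_ubound; exists f1.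
have worst_ge g : (risk m K H f1 g <= worst_risk m K H c g)%E.
  by apply: ereal_sup_ubound; exists f1.
split.
  split; first exact: eg.
  move=> g [mg _]; rewrite worst; apply: le_trans (worst_ge g).
  rewrite (risk_gap mg pQ1) leeDl//; apply: integral_ge0 => s _.
  by rewrite lee_fin mulr_ge0 ?sqnorm_ge0 ?gauss_density_ge0.
move=> g [[mg _] ming]; apply: (@estimator_gap_ae0 g Q1) => //.
(* The risk of a minimizer under the saddle law is at most the value of the game. That value is
   finite and can be cancelled, which forces the gap integral to be zero. *)
have := le_trans (worst_ge g) (ming _ eg).
rewrite worst (risk_gap mg pQ1) r1 -[X in (_ <= X)%E]adde0 leeD2lE//.
move=> le0; apply/eqP; rewrite eq_le le0; apply: integral_ge0 => s _.
by rewrite lee_fin mulr_ge0 ?sqnorm_ge0 ?gauss_density_ge0.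
Qed.

End GameCoordinates.

(** * Least favorable density and its uniqueness *)

Section LeastFavorable.
Variables (R : realType) (n p r : nat).
Variables (H : 'M[R]_(r, n)) (G : 'M[R]_(n, p)) (Q : 'M[R]_r) (Ky : 'M[R]_p).
Variable m : 'cV[R]_(n + p).
Hypotheses (HH : H *m H^T = 1%:M) (pQ : posdef Q) (pKy : posdef Ky).

Local Notation Z := (game_frame H G).
Local Notation T := (frame_cov Ky).
Local Notation K := (Z *m T Q *m Z^T).
Local Notation X := (state_proj R p r).

Lemma gauss_kl_frame_cov Q1 : posdef Q1 ->
  gauss_kl 0 (T Q1) (T Q) = gauss_kl 0 Q1 Q.
Proof.
move=> pQ1; have dQ := posdef_det_gt0 pQ; have dQ1 := posdef_det_gt0 pQ1.
have dK := posdef_det_gt0 pKy.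
have uT := posdef_unitmx (posdef_frame_cov pKy pQ).
rewrite !gauss_kl0 /frame_cov !det_ublock invmx_block_diag//.
rewrite mulmx_block mxtrace_block !(mulmx0, mul0mx, addr0, add0r).
rewrite mulVmx ?posdef_unitmx// mxtrace1 !lnM ?posrE// natrD.
by congr (_ * _); ring.
Qed.

(** For [theta > 0] this is the tilting bound. For [theta = 0] the radius is zero as well, and the
    nominal law is the only competitor. *)
Lemma game_maximizer theta c mu T1 : posdef (tilt Q theta) ->
  invmx Q - theta%:M \in unitmx -> 0 < theta \/ theta = 0 /\ c = 0 ->
  gauss_kl 0 (tilt Q theta) Q = c ->
  posdef T1 -> gauss_kl mu T1 (T Q) <= c ->
  \tr (X *m T1) + (mu^T *m X *m mu) ord0 ord0 <= \tr (X *m T (tilt Q theta))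
    ?= iff (T1 == T (tilt Q theta)) && (mu == 0).
Proof.
move=> pt ut thc klc pT1 kl; have pT0 := posdef_frame_cov pKy pQ.
have pT := posdef_frame_cov pKy pt.
case: thc => [th0|[th0 c0]]; last first.
  have [-> ->] : T1 = T Q /\ mu = 0 by apply: gauss_kl_le0_eq => //; rewrite -c0.
  rewrite th0 tilt0 mulmx0 [X in _ + X]mxE addr0 !eqxx; exact: leif_refl.
(* The two precisions share the innovation block and differ by [theta] times the identity on the
   state block. *)
suff XE : theta *: X = invmx (T Q) - invmx (T (tilt Q theta)).
  apply: (gauss_kl_maximizer pT1 pT0 pT th0 XE).
  by rewrite gauss_kl_frame_cov// klc.
rewrite !invmx_block_diag ?posdef_unitmx// /tilt invmxK /state_proj.
rewrite scale_block_mx opp_block_mx add_block_mx !scaler0 !subrr.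
by rewrite opprB addrC subrK scalemx1.
Qed.

Lemma least_favorable_unique c Q1 : posdef Q1 -> gauss_kl 0 (T Q1) (T Q) <= c ->
  (forall mu T1, posdef T1 -> gauss_kl mu T1 (T Q) <= c ->
     \tr (X *m T1) + (mu^T *m X *m mu) ord0 ord0 <= \tr (X *m T Q1)
       ?= iff (T1 == T Q1) && (mu == 0)) ->
  let f1 := gauss_pdf m (Z *m T Q1 *m Z^T) in
  least_favorable m K H c (affine_estimator G m) f1 /\
  forall ft, least_favorable m K H c (affine_estimator G m) ft -> ft = f1.
Proof.
move=> pQ1 kl1 max f1; have pT1 := posdef_frame_cov pKy pQ1.
have f1E : f1 = gauss_pdf (m + Z *m 0) (Z *m T Q1 *m Z^T).
  by rewrite mulmx0 addr0.
have af1 : ambiguity_set m K c f1.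
  by apply/(ambiguity_coords G m HH pQ pKy); exists 0, (T Q1).
have r1 : risk m K H f1 (affine_estimator G m) = (\tr (X *m T Q1))%:E.
  by rewrite f1E risk_affine_estimator// mulmx0 [X in _ + X]mxE addr0.
split.
  split=> // ft /(ambiguity_coords G m HH pQ pKy)[mu [T1 [pT -> kl]]].
  by rewrite r1 risk_affine_estimator// lee_fin (max mu T1 pT kl).
move=> ft [/(ambiguity_coords G m HH pQ pKy)[mu [T1 [pT -> kl]]] /(_ _ af1)].
rewrite r1 risk_affine_estimator// lee_fin; have [le eq] := max mu T1 pT kl => ge.
have /andP[/eqP -> /eqP ->] : (T1 == T Q1) && (mu == 0) by rewrite -eq eq_le le ge.
by rewrite f1E.
Qed.

Lemma game_frame_cov Q1 : Z *m T Q1 *m Z^T =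
  block_mx (H^T *m Q1 *m H + G *m Ky *m G^T) (G *m Ky) (Ky *m G^T) Ky.
Proof.
rewrite /game_frame /frame_cov tr_block_mx !mulmx_block trmxK trmx1 !trmx0.
by rewrite !(mulmx0, mul0mx, addr0, add0r, mulmx1, mul1mx).
Qed.

Lemma state_proj_eq0 : r = 0%N -> X = 0.
Proof.
move=> r0; rewrite /state_proj (_ : 1%:M = 0) ?block_mx0//.
by apply/matrixP => -[i lti]; exfalso; rewrite r0 in lti.
Qed.

End LeastFavorable.

(** * Schur complements and the compression by [H] *)

Section NominalModel.
Variable R : realType.

Lemma nominal_covE n p (A : 'M[R]_n) (B : 'M[R]_(n, n + p)) (C : 'M[R]_(p, n))
    (D : 'M[R]_(p, n + p)) (Pt : 'M[R]_n) :
  nominal_cov A B C D Pt =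
  block_mx (A *m Pt *m A^T + B *m B^T) (A *m Pt *m C^T + B *m D^T)
           (C *m Pt *m A^T + D *m B^T) (C *m Pt *m C^T + D *m D^T).
Proof.
by rewrite /nominal_cov mul_col_mx !mul_col_row add_block_mx.
Qed.

Lemma psd_nominal_cov n p (A : 'M[R]_n) (B : 'M[R]_(n, n + p)) (C : 'M[R]_(p, n))
    (D : 'M[R]_(p, n + p)) (Pt : 'M[R]_n) : psd Pt -> psd (nominal_cov A B C D Pt).
Proof.
move=> pP; rewrite /nominal_cov -!tr_col_mx; apply: psdD.
  by rewrite -{1}[col_mx A C]trmxK; exact: psd_congr.
split=> [|v]; first by rewrite trmx_mul trmxK.
by rewrite quadE sqnorm_ge0.
Qed.

(** The gain is chosen to make the residual [x - G y] uncorrelated with [y]; the covariance is then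
    reassembled from those of the residual and of [y]. *)
Lemma posterior_cov_schur n p (K : 'M[R]_(n + p)) : K^T = K ->
  drsubmx K \in unitmx ->
  K = block_mx (posterior_cov K + filter_gain K *m drsubmx K *m (filter_gain K)^T)
        (filter_gain K *m drsubmx K) (drsubmx K *m (filter_gain K)^T) (drsubmx K).
Proof.
move=> symK uKy; have symKy : (drsubmx K)^T = drsubmx K by rewrite trmx_drsub symK.
have Kyx : dlsubmx K = (ursubmx K)^T by rewrite trmx_ursub symK.
rewrite -[LHS]submxK; congr block_mx.
- rewrite /posterior_cov /filter_gain mulmxKV// trmx_mul trmx_inv symKy -Kyx.
  by rewrite mulmxA subrK.
- by rewrite /filter_gain mulmxKV.
- by rewrite /filter_gain trmx_mul trmx_inv symKy mulKVmx.
Qed.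

(** Congruence by the column [[1; - G^T]] extracts the covariance of [x - G y]. *)
Lemma psd_posterior_cov n p (K : 'M[R]_(n + p)) : psd K ->
  drsubmx K \in unitmx -> psd (posterior_cov K).
Proof.
move=> pK uKy; have symKy : (drsubmx K)^T = drsubmx K by rewrite trmx_drsub pK.1.
have := posterior_cov_schur pK.1 uKy.
move: (filter_gain K) (posterior_cov K) (drsubmx K) => G P Ky KE.
have := psd_congr (col_mx 1%:M (- G^T)) pK.
rewrite KE tr_col_mx trmx1 [(- G^T)^T]raddfN/= trmxK.
rewrite mul_row_block !mul1mx !mulNmx mul_row_col mulmx1 mulmxA subrr mul0mx addr0.
by rewrite addrK.
Qed.

Lemma mximage_submx k (A B : 'M[R]_k) : mximage A `<=` mximage B ->
  exists X, A = B *m X.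
Proof.
move=> AB; suff /submxP[X XE] : (A^T <= B^T)%MS.
  by exists X^T; rewrite -[A]trmxK XE trmx_mul trmxK.
apply/row_subP => j; have [v _ e] : mximage B (A *m delta_mx j ord0).
  by apply: AB; exists (delta_mx j ord0).
apply/submxP; exists v^T.
by rewrite -trmx_mul e trmx_mul trmx_delta -rowE.
Qed.

(** The image has dimension [r], the number of rows of [H], so [H] has full row rank. It can
    therefore be cancelled twice in the idempotency [H^T H H^T H = H^T H], leaving [H H^T = 1]. *)
Lemma projection_coisometry r n (H : 'M[R]_(r, n)) (P : 'M[R]_n) :
  \rank P = r -> projection_onto (H^T *m H) (mximage P) ->
  H *m H^T = 1%:M /\ H^T *m H *m P = P.
Proof.
move=> rP [HHHH imE].
have [X PX] : exists X, P = H^T *m H *m X by apply: mximage_submx; rewrite imE.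
have freeH : row_free H.
  rewrite /row_free eqn_leq rank_leq_row -{1}rP PX.
  by rewrite (leq_trans (mxrankM_maxl _ _))// mxrankM_maxr.
split; last by rewrite {1}PX mulmxA HHHH -PX.
have h1 : (H^T *m H *m H^T) = H^T.
  by apply: (row_free_inj freeH); rewrite -!mulmxA mulmxA -[RHS]HHHH !mulmxA.
apply: trmx_inj; apply: (row_free_inj freeH).
rewrite trmx_mul trmxK trmx1 mul1mx; apply: trmx_inj.
by rewrite !trmx_mul trmxK mulmxA h1.
Qed.

Lemma posdef_compression r n (H : 'M[R]_(r, n)) (P : 'M[R]_n) :
  psd P -> \rank P = r -> H^T *m H *m P = P ->
  posdef (H *m P *m H^T) /\ P = H^T *m (H *m P *m H^T) *m H.
Proof.
move=> pP rP HP.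
have PH : P *m H^T *m H = P.
  by apply: trmx_inj; rewrite !trmx_mul trmxK pP.1 mulmxA.
have PE : P = H^T *m (H *m P *m H^T) *m H.
  by rewrite !mulmxA HP PH.
split=> //; apply: psd_unit_posdef.
  by rewrite -{1}[H]trmxK; exact: psd_congr.
rewrite -row_full_unit /row_full eqn_leq rank_leq_row -{1}rP {1}PE.
by rewrite (leq_trans (mxrankM_maxl _ _))// mxrankM_maxr.
Qed.

End NominalModel.

Theorem mainTheorem2 (R : realType) (n p : nat)
  (A : 'M[R]_n) (B : 'M[R]_(n, n + p)) (C : 'M[R]_(p, n)) (D : 'M[R]_(p, n + p))
  (hD : posdef (D *m D^T))
  (xhat : 'cV[R]_n) (Pt : 'M[R]_n) (hPt : psd Pt)
  (rt : nat) (hrt : \rank Pt = rt)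
  (r : nat) (hr : \rank (posterior_cov (nominal_cov A B C D Pt)) = r)
  (H : 'M[R]_(r, n))
  (hH : projection_onto (H^T *m H)
          (mximage (posterior_cov (nominal_cov A B C D Pt))))
  (c : R) (hc : 0 <= c) :
  let m := nominal_mean A C xhat in
  let K := nominal_cov A B C D Pt in
  let P := posterior_cov K in
  let G := filter_gain K in
  let ghat := fun y : 'cV[R]_p => A *m xhat + G *m (y - C *m xhat) in
  [/\ [/\ G = (A *m Pt *m C^T + B *m D^T) *m invmx (C *m Pt *m C^T + D *m D^T),
          robust_estimator m K H c ghat &
          forall g, robust_estimator m K H c g ->
            {ae lebesgue_cV R p, forall y, H *m g y = H *m ghat y}],
      P = A *m Pt *m A^T - G *m (C *m Pt *m C^T + D *m D^T) *m G^T + B *m B^T &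
      (0 < r)%N ->
      exists (lambda : \bar R) (Kxt : 'M[R]_n),
        let theta := fine (lambda^-1)%E in
        let Kt := block_mx Kxt (ursubmx K) (dlsubmx K) (drsubmx K) in
        let sigma := sigma_max (H *m H^T *m invmx (H *m mp_inv P *m H^T)
                                  *m (H *m H^T)) in
        [/\ [/\ psd Kt,
                least_favorable m K H c ghat (gauss_pdf m Kt) &
                forall ft, least_favorable m K H c ghat ft -> ft = gauss_pdf m Kt],
            posterior_cov Kt = robust_cov P H lambda,
            [/\ (sigma%:E < lambda)%E, budget P (robust_cov P H lambda) = c &
                forall lambda' : \bar R, (sigma%:E < lambda')%E ->
                  budget P (robust_cov P H lambda') = c -> lambda' = lambda],
            0 < c -> lambda \is a fin_num &
            c = 0 ->
              [/\ theta = 0, posterior_cov Kt = P,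
                  posterior_cov Kt = riccati A B C D Pt &
                  ghat = kalman_predictor A B C D Pt xhat]]].
Proof.
set K0 := nominal_cov A B C D Pt in hr hH.
move=> m K P G ghat.
have KE : K = block_mx (A *m Pt *m A^T + B *m B^T) (A *m Pt *m C^T + B *m D^T)
    (C *m Pt *m A^T + D *m B^T) (C *m Pt *m C^T + D *m D^T) := nominal_covE A B C D Pt.
have Kxy : ursubmx K = A *m Pt *m C^T + B *m D^T by rewrite KE block_mxKur.
have Kyy : drsubmx K = C *m Pt *m C^T + D *m D^T by rewrite KE block_mxKdr.
have Kxx : ulsubmx K = A *m Pt *m A^T + B *m B^T by rewrite KE block_mxKul.
have pK : psd K := psd_nominal_cov A B C D hPt.
have pKy : posdef (drsubmx K).
  rewrite Kyy; apply: posdef_psdD => //; rewrite -{1}[C]trmxK; exact: psd_congr.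
have uKy := posdef_unitmx pKy.
have symKy : (drsubmx K)^T = drsubmx K := pKy.1.
have Kyx : dlsubmx K = (ursubmx K)^T by rewrite trmx_ursub pK.1.
have pP : psd P by exact: psd_posterior_cov.
have [HH HP] := projection_coisometry hr hH.
have [pQ PE] := posdef_compression pP hr HP.
pose Q := H *m P *m H^T; rewrite -/Q in pQ PE.
have uQ := posdef_unitmx pQ.
have GK : G *m drsubmx K = ursubmx K by rewrite /G /filter_gain mulmxKV.
have KG : drsubmx K *m G^T = dlsubmx K.
  by rewrite Kyx -GK (trmx_mul G) symKy.
have GKG : ursubmx K *m invmx (drsubmx K) *m dlsubmx K = G *m drsubmx K *m G^T.
  by rewrite -[RHS]mulmxA KG.
(* Changing the state block [Q1] alters only the covariance of [x]; this is the shape claimed for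
   the least favorable covariance, and [Q1 = Q] gives back [K]. *)
have frameE Q1 : game_frame H G *m frame_cov (drsubmx K) Q1 *m (game_frame H G)^T =
    block_mx (H^T *m Q1 *m H + G *m drsubmx K *m G^T) (ursubmx K) (dlsubmx K) (drsubmx K).
  by rewrite game_frame_cov GK KG.
have frameK : game_frame H G *m frame_cov (drsubmx K) Q *m (game_frame H G)^T = K.
  by rewrite frameE -PE -GK -KG -(posterior_cov_schur pK.1 uKy).
have ghatE : ghat = affine_estimator G m.
  apply/funext => y; rewrite /ghat /affine_estimator /m /nominal_mean mul_col_mx.
  by rewrite col_mxKu col_mxKd.
have postE Q1 : posterior_cov (block_mx (H^T *m Q1 *m H + G *m drsubmx K *m G^T)
    (ursubmx K) (dlsubmx K) (drsubmx K)) = H^T *m Q1 *m H.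
  rewrite /posterior_cov block_mxKul block_mxKur block_mxKdr block_mxKdl.
  by rewrite GKG addrK.
have PE' : P = A *m Pt *m A^T
    - G *m (C *m Pt *m C^T + D *m D^T) *m G^T + B *m B^T.
  by rewrite -Kyy -GKG addrAC -Kxx.
split.
- suff [robust uniq] : robust_estimator m K H c ghat /\
      (forall g, robust_estimator m K H c g ->
        {ae lebesgue_cV R p, forall y, H *m g y = H *m ghat y}).
    by split=> //; rewrite /G /filter_gain Kxy Kyy.
  have := @affine_estimator_robust R n p r H G Q (drsubmx K) m HH pQ pKy c.
  rewrite frameK ghatE => robust.
  (* For [r = 0] there is no multiplier, but [state_proj] is zero and every law has the same risk,
     so the nominal law serves as saddle law. *)
  have [r0|r0] := posnP r; last first.
    have [lambda [[_ pt ut] _ klc _ lc]] := robust_multiplier r0 HH pQ hc.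
    apply: (robust _ pt).
      by rewrite gauss_kl_frame_cov// klc.
    move=> mu T1 pT1 kl.
    have thc : 0 < fine lambda^-1%E \/ fine lambda^-1%E = 0 /\ c = 0.
      by case: lc => [[-> c0]|[_ [t0 _]]]; [right; rewrite invey|left].
    by have [] := game_maximizer pQ pKy pt ut thc klc pT1 kl.
  apply: (robust _ pQ).
    by rewrite gauss_klxx// posdef_unitmx//; exact: posdef_frame_cov.
  move=> mu T1 _ _; have -> : state_proj R p r = 0 by exact: state_proj_eq0.
  by rewrite mulmx0 !mul0mx !mxtrace0 mxE addr0.
- exact: PE'.
move=> r0; have [lambda [[th0 pt ut] sl klc luniq lc]] := robust_multiplier r0 HH pQ hc.
set theta := fine lambda^-1%E in th0 pt ut klc lc.
pose Q1 := tilt Q theta.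
have rcE : robust_cov P H lambda = H^T *m Q1 *m H.
  by rewrite {1}PE robust_cov_coisometry.
exists lambda, (H^T *m Q1 *m H + G *m drsubmx K *m G^T); rewrite -/theta.
have thc : 0 < theta \/ theta = 0 /\ c = 0.
  by case: lc => [[le c0]|[_ [t0 _]]]; [right; rewrite /theta le invey|left].
have pT1 := posdef_frame_cov pKy pt.
move=> theta0 Kt sigma.
have KtE : Kt = game_frame H G *m frame_cov (drsubmx K) Q1 *m (game_frame H G)^T.
  by rewrite frameE.
have sigmaE : sigma = sigma_max Q.
  by rewrite /sigma {1}PE sigma_max_coisometry.
have post : posterior_cov Kt = H^T *m Q1 *m H by exact: postE.
have kl1 : gauss_kl 0 (frame_cov (drsubmx K) Q1) (frame_cov (drsubmx K) Q) <= c.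
  by rewrite gauss_kl_frame_cov// klc.
have [lf lfu] := @least_favorable_unique R n p r H G Q (drsubmx K) m HH pQ pKy c Q1
  pt kl1 (fun mu T1 pT1 => game_maximizer pQ pKy pt ut thc klc pT1).
rewrite frameK -KtE -ghatE in lf lfu.
split.
- split=> //; rewrite KtE -{1}[game_frame H G]trmxK.
  exact/psd_congr/posdef_psd.
- by rewrite rcE.
- rewrite sigmaE; split=> //.
    by rewrite rcE {1}PE budget_coisometry.
  by move=> l sl' bl; apply: luniq => //; rewrite -PE.
- by case: lc => [[_ ->]|[]//]; rewrite ltxx.
move=> c0; have th00 : theta = 0.
  by case: thc => [t0|[]//]; case: lc => [[le _]|[_ [_]]]; rewrite ?c0 ?ltxx// /theta le invey.
have postP : posterior_cov Kt = P by rewrite post /Q1 th00 tilt0 -PE.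
split=> //.
  rewrite postP PE' /riccati -Kyy -Kxy; congr (_ - _ + _).
  by rewrite -Kyx -GKG.
by apply/funext => y; rewrite /ghat /kalman_predictor /kalman_gain /G /filter_gain Kxy Kyy.
Qed.
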